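(* For $d\in\{2,\dots,10\}$ the Hausdorff dimension $\dim_H(\mathcal J_{\mathcal T^d})$ of the Julia set $\mathcal J_{\mathcal T^d}$ associated to the Sierpiński gasket in $d$ dimensions is given by the following values, accurate to the number of decimals stated (i.e. $a_d\le\dim_H(\mathcal J_{\mathcal T^d})\le a_d+10^{-14}$, where $a_d$ is the displayed truncated decimal): $$\begin{array}{c|c} d&\dim_H(\mathcal J_{\mathcal T^d})\\ \hline 2&0.55161856837246\ldots\\ 3&0.45183750018171\ldots\\ 4&0.39795943979056\ldots\\ 5&0.36287714809375\ldots\\ 6&0.33770271892130\ldots\\ 7&0.31850809575800\ldots\\ 8&0.30324865557723\ldots\\ 9&0.29074069840192\ldots\\ 10&0.28024518050407\ldots\end{array}$$
   Context: For an integer $d\ge2$, the decimation polynomial associated to the $d$-dimensional Sierpiński gasket is $R_{\mathcal T^d}:[0,3+d]\to\mathbb R$, $R_{\mathcal T^d}(x)=x((3+d)-x)$. Its two local inverses $S_{\pm1,\mathcal T^d}:[0,3+d]\to[0,3+d]$ are $$S_{\epsilon,\mathcal T^d}(x)=\tfrac12\left(3+d+\epsilon\sqrt{9+6d+d^2-4x}\right),\qquad \epsilon=\pm1.$$ The Julia set $\mathcal J_{\mathcal T^d}\subset[0,3+d]$ is the smallest non-empty closed set such that $\mathcal J_{\mathcal T^d}=S_{-1,\mathcal T^d}(\mathcal J_{\mathcal T^d})\cup S_{+1,\mathcal T^d}(\mathcal J_{\mathcal T^d})$. $\dim_H$ denotes the Hausdorff dimension. *)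

(* Defs.v *)
From HB Require Import structures.
From mathcomp Require Import all_boot all_order all_algebra.
From mathcomp Require Import all_classical all_reals all_analysis.
From mathcomp Require Import ring lra.

Set Implicit Arguments.
Unset Strict Implicit.
Unset Printing Implicit Defensive.

Import Order.TTheory GRing.Theory Num.Theory.
Import numFieldNormedType.Exports.

Local Open Scope classical_set_scope.
Local Open Scope ring_scope.

Section Hausdorff.
Context {R : realType} {T : normedModType R}.
Implicit Types (s delta : R) (A U : set T).

(* [diam set0] is -oo, so the empty set may occur in any delta-cover. *)
Definition diam U : \bar R :=
  ereal_sup [set `|x.1 - x.2|%:E | x in U `*` U].

(* diam(U)^s, with the convention that the empty set contributes 0 even when
   s = 0 (whereas 0^0 = 1, so that the 0-dimensional measure counts points). *)
Definition hausdorff_gauge s U : \bar R :=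
  if U == set0 then 0%E else (diam U `^ s)%E.

(* Covers are indexed by nat; finite ones are padded with empty sets. *)
Definition delta_cover delta A : set (nat -> set T) :=
  [set U | A `<=` \bigcup_k U k /\ forall k, (diam (U k) <= delta%:E)%E].

Definition hausdorff_content s delta A : \bar R :=
  ereal_inf [set (\sum_(0 <= k <oo) hausdorff_gauge s (U k))%E
            | U in delta_cover delta A].

Definition hausdorff_measure s A : \bar R :=
  ereal_sup [set hausdorff_content s delta A | delta in [set delta | 0 < delta]].

Definition hausdorff_dim A : \bar R :=
  ereal_inf [set s%:E | s in [set s | 0 <= s /\ hausdorff_measure s A = 0%E]].

End Hausdorff.

Section JuliaSet.
Context {R : realType}.
Implicit Types (d : nat) (x eps : R) (K : set R).

Definition decimation d x : R := x * ((3 + d%:R) - x).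

Definition local_inverse d eps x : R :=
  2^-1 * (3 + d%:R + eps * Num.sqrt (9 + 6 * d%:R + d%:R ^+ 2 - 4 * x)).

Definition julia_invariant d K : Prop :=
  [/\ K `<=` `[0, 3 + d%:R], closed K, K !=set0 &
      K = local_inverse d (-1) @` K `|` local_inverse d 1 @` K].

Definition julia_set d : set R := smallest (julia_invariant d) set0.

Let disc d x : 9 + 6 * d%:R + d%:R ^+ 2 - 4 * x = (3 + d%:R) ^+ 2 - 4 * x :> R.
Proof. by ring. Qed.

Lemma local_inverseK d eps x : (2 <= d)%N -> eps ^+ 2 = 1 ->
  x \in `[0, 3 + d%:R] -> decimation d (local_inverse d eps x) = x.
Proof.
move=> d2 e1; rewrite in_itv/= => /andP[x0 xb].
have d2R : 2 <= d%:R :> R by rewrite (ler_nat _ 2).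
rewrite /decimation /local_inverse disc.
have /sqr_sqrtr : 0 <= (3 + d%:R) ^+ 2 - 4 * x by nra.
set r := Num.sqrt _ => r2.
suff : 4 * x = (3 + d%:R) ^+ 2 - eps ^+ 2 * r ^+ 2 by move=> h; lra.
by rewrite e1 r2; ring.
Qed.

Lemma julia_invariant0 d K : (2 <= d)%N -> julia_invariant d K -> K 0.
Proof.
move=> d2 [Kb Kc [z Kz] KE].
have d2R : 2 <= d%:R :> R by rewrite (ler_nat _ 2).
have lbK : has_inf K.
  by split; [exists z | exists 0 => y /Kb; rewrite /= in_itv/= => /andP[]].
have Km : K (inf K).
  suff : closure K (inf K) by rewrite -((closure_id K).1 Kc).
  move=> B /nbhs_ballP[e /= e0 eB].
  have [y Ky ye] := inf_adherent e0 lbK.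
  exists y; split=> //; apply: eB.
  have my : inf K <= y by apply: ge_inf => //; exact: lbK.2.
  by rewrite -ball_normE /ball_/= ler0_norm ?subr_le0//; lra.
have : K (local_inverse d (-1) (inf K)) by rewrite {1}KE; left; exists (inf K).
move: (Km) => /Kb; rewrite /= in_itv/= => /andP[m0 mb].
move=> /(ge_inf lbK.2); rewrite /local_inverse disc.
have h : 0 <= (3 + d%:R) ^+ 2 - 4 * inf K by nra.
have : 3 + d%:R - inf K <= Num.sqrt ((3 + d%:R) ^+ 2 - 4 * inf K).
  by rewrite -[leLHS]ger0_norm ?subr_ge0// -sqrtr_sqr ler_wsqrtr//; nra.
move=> h1 h2; have m00 : inf K = 0 by lra.
by rewrite -m00.
Qed.

Let local_inverse_itv d eps x : (2 <= d)%N -> eps ^+ 2 = 1 ->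
  x \in `[0, 3 + d%:R] -> local_inverse d eps x \in `[0, 3 + d%:R].
Proof.
move=> d2 e1; rewrite !in_itv/= => /andP[x0 xb].
have d2R : 2 <= d%:R :> R by rewrite (ler_nat _ 2).
rewrite /local_inverse disc.
have /sqr_sqrtr : 0 <= (3 + d%:R) ^+ 2 - 4 * x by nra.
have := sqrtr_ge0 ((3 + d%:R) ^+ 2 - 4 * x).
set r := Num.sqrt _ => r0 r2.
have rb : r <= 3 + d%:R by rewrite -(@ler_pXn2r _ 2) ?nnegrE//; lra.
have /orP[/eqP->|/eqP->] : (eps == 1) || (eps == -1) by rewrite -sqrf_eq1 e1.
  by apply/andP; split; lra.
by apply/andP; split; lra.
Qed.

Let decimationK d x : local_inverse d (-1) (decimation d x) = x \/
  local_inverse d 1 (decimation d x) = x.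
Proof.
rewrite /local_inverse disc /decimation.
have -> : (3 + d%:R) ^+ 2 - 4 * (x * (3 + d%:R - x)) = (3 + d%:R - 2 * x) ^+ 2.
  by ring.
rewrite sqrtr_sqr; have [h|h] := leP 0 (3 + d%:R - 2 * x).
  by left; rewrite ger0_norm//; lra.
by right; rewrite ltr0_norm//; lra.
Qed.

(* The set of points whose forward orbit stays in the interval. *)
Let julia_invariant_orbit d : (2 <= d)%N -> julia_invariant d
  [set x | forall n, iter n (decimation d) x \in `[0, 3 + d%:R]].
Proof.
move=> d2; have d2R : 2 <= d%:R :> R by rewrite (ler_nat _ 2).
split.
- by move=> x /(_ 0%N).
- rewrite (_ : [set _ | _] = \bigcap_n (iter n (decimation d) @^-1` `[0, 3 + d%:R])).
    apply: closed_bigI => n _; apply: preimage_closed; last exact: itv_closed.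
    move=> x _; elim: n x => [|n ih] x; first exact: cvg_id.
    rewrite /= /decimation.
    apply: (@continuousM _ _ (iter n (decimation d))); first exact: ih.
    by apply: continuousB; [exact: cvg_cst|exact: ih].
  by apply/seteqP; split=> [x h n _|x h n]; [exact: h|exact: (h n I)].
- exists 0 => n /=; suff -> : iter n (decimation d) 0 = 0 :> R.
    by rewrite in_itv/= lexx/=; lra.
  by elim: n => // n /= ->; rewrite /decimation mul0r.
- apply/seteqP; split=> [x h|x].
    have h' : forall n, iter n (decimation d) (decimation d x) \in `[0, 3 + d%:R].
      by move=> n; rewrite -iterSr; exact: h.
    by have [e|e] := decimationK d x; [left|right]; exists (decimation d x).
  have aux eps y : eps ^+ 2 = 1 ->
    (forall n, iter n (decimation d) y \in `[0, 3 + d%:R]) ->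
    forall n, iter n (decimation d) (local_inverse d eps y) \in `[0, 3 + d%:R].
    move=> e1 h [|n]; first by apply: local_inverse_itv => //; exact: (h 0%N).
    by rewrite iterSr local_inverseK//; exact: (h 0%N).
  by case=> -[y h <-]; apply: aux => //; rewrite ?expr1n// sqrrN expr1n.
Qed.

Lemma julia_set_sub d K : julia_invariant d K -> julia_set d `<=` K.
Proof. by move=> KJ; apply: smallest_sub. Qed.

(* The intersection of all invariant sets is itself invariant, so [julia_set]
   is indeed the smallest of them. *)
Lemma julia_set_invariant d : (2 <= d)%N -> julia_invariant d (julia_set d).
Proof.
move=> d2; have d2R : 2 <= d%:R :> R by rewrite (ler_nat _ 2).
have Jb : julia_set d `<=` `[0, 3 + d%:R].
  by move=> x /(julia_set_sub (julia_invariant_orbit d2))/(_ 0%N).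
split=> //.
- by apply: closed_bigI => K [[]].
- by exists 0 => K [KJ _]; exact: julia_invariant0 KJ.
- apply/seteqP; split=> [x Jx|x].
    have Jx' : julia_set d (decimation d x).
      move=> K [KJ _]; have [Kb _ _ KE] := KJ.
      have := julia_set_sub KJ Jx; rewrite {1}KE.
      by case=> -[y Ky <-]; rewrite local_inverseK ?sqrrN ?expr1n//; exact: Kb.
    by have [e|e] := decimationK d x; [left|right]; exists (decimation d x).
  case=> -[y Jy <-] K [KJ _]; have [_ _ _ KE] := KJ.
    by rewrite KE; left; exists y => //; apply: (julia_set_sub KJ Jy).
  by rewrite KE; right; exists y => //; apply: (julia_set_sub KJ Jy).
Qed.

End JuliaSet.

(* The real number 0.c_1c_2...c_n in base ten. *)
Definition decimal {R : realType} (c : seq nat) : R :=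
  foldr (fun k x => (k%:R + x) / 10) 0 c.

(* The fourteen displayed decimals of the dimension for 2 <= d <= 10. *)
Definition julia_dim_digits (d : nat) : seq nat :=
  match d with
  | 2 => [:: 5; 5; 1; 6; 1; 8; 5; 6; 8; 3; 7; 2; 4; 6]
  | 3 => [:: 4; 5; 1; 8; 3; 7; 5; 0; 0; 1; 8; 1; 7; 1]
  | 4 => [:: 3; 9; 7; 9; 5; 9; 4; 3; 9; 7; 9; 0; 5; 6]
  | 5 => [:: 3; 6; 2; 8; 7; 7; 1; 4; 8; 0; 9; 3; 7; 5]
  | 6 => [:: 3; 3; 7; 7; 0; 2; 7; 1; 8; 9; 2; 1; 3; 0]
  | 7 => [:: 3; 1; 8; 5; 0; 8; 0; 9; 5; 7; 5; 8; 0; 0]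
  | 8 => [:: 3; 0; 3; 2; 4; 8; 6; 5; 5; 5; 7; 7; 2; 3]
  | 9 => [:: 2; 9; 0; 7; 4; 0; 6; 9; 8; 4; 0; 1; 9; 2]
  | 10 => [:: 2; 8; 0; 2; 4; 5; 1; 8; 0; 5; 0; 4; 0; 7]
  | _ => [::]
  end%N.

(* Main.v *)
(** With [c = 3 + d] and [w x = sqrt (c^2 - 4x)], the inverse branches are
    [(c -+ w x) / 2], with derivative [1 / w] in absolute value, and the
    transfer operator is [L_s g x = w x ^ (-s) (g (S- x) + g (S+ x))].  If a
    positive continuous [f] satisfies [L_b f <= f] on [[0, c]], refining the
    covers of the Julia set by the branches makes the sums [|u - v|^s f u] decay
    geometrically for [s > b], so the dimension is at most [b].  If
    [L_a f >= f], then for [s < a] the mass [L_s^n 1_V x / L_s^n f x] is at most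
    a constant times [diam V ^ s], so the dimension is at least [a].

    A polynomial [f] close to the eigenfunction serves for both ends [a] and
    [b = a + 10^-14].  Since [f (S- x) + f (S+ x)] is a polynomial [F], the sign
    of the derivative of [ln F - s ln w - ln f] is that of a polynomial with
    integer coefficients; its sign on [[0, c]] and the value of that function at
    [x = c] are certified by integer arithmetic. *)

Require Import Defs.
From Stdlib Require Import ZArith.
From mathcomp Require Import all_boot all_order all_algebra.
From mathcomp Require Import all_classical all_reals all_analysis.
From mathcomp Require Import ring lra.
From mathcomp Require Import ssrZ.

Set Implicit Arguments.
Unset Strict Implicit.
Unset Printing Implicit Defensive.

Import Order.TTheory GRing.Theory Num.Theory.
Import numFieldNormedType.Exports.

Local Open Scope classical_set_scope.
Local Open Scope ring_scope.

(** * Integer polynomials, sign tests and logarithms for the certificates *)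

Local Open Scope Z_scope.

Fixpoint padd (p q : seq Z) : seq Z :=
  match p, q with
  | a :: p', b :: q' => a + b :: padd p' q'
  | [::], _ => q
  | _, [::] => p
  end.

Definition pscale (k : Z) : seq Z -> seq Z := map (Z.mul k).

Definition popp : seq Z -> seq Z := map Z.opp.

Fixpoint pmul (p q : seq Z) : seq Z :=
  if p is a :: p' then padd (pscale a q) (0 :: pmul p' q) else [::].

Fixpoint pderiv (p : seq Z) : seq Z :=
  if p is a :: p' then padd p' (0 :: pderiv p') else [::].

Definition psum : seq Z -> Z := foldr Z.add 0.

Fixpoint pflip (p : seq Z) : seq Z :=
  if p is a :: p' then a :: popp (pflip p') else [::].

(** The substitution of 1 - x for x lets [pbisect] treat the right half of [0, 1] as a left half. *)
Fixpoint preflect (p : seq Z) : seq Z :=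
  if p is a :: p' then
    let r := preflect p' in padd (padd [:: a] r) (0 :: popp r)
  else [::].

(** Dropping zeros of highest degree shortens the polynomial, and with it the error [size p] charged
    by later uses of [pfloor]. *)
Definition pcons (a : Z) (p : seq Z) : seq Z :=
  if p is [::] then if a =? 0 then [::] else [:: a] else a :: p.

(* Truncation of the coefficients of [p (x / 2^e) / 2^s]. *)
Fixpoint ptrunc (e s : nat) (p : seq Z) : seq Z :=
  if p is a :: p' then pcons (iter s Z.quot2 a) (ptrunc e (s + e) p')
  else [::].

(* Each truncation errs by less than 1, so for [|x| <= 1] the constant term
   absorbs all the errors and [pfloor] is a lower bound. *)
Definition pfloor (e s : nat) (p : seq Z) : seq Z :=
  padd [:: - Z.of_nat (size p)] (ptrunc e s p).

(* Horner's scheme on [0, 1], keeping only lower bounds. *)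
Fixpoint plower (p : seq Z) : Z :=
  if p is a :: p' then a + Z.min 0 (plower p') else 0.

(** Rescaling a half to [0, 1] divides the coefficient of degree j by 2^j, so the Horner bound
    sharpens with the depth. *)
Fixpoint pbisect (depth : nat) (p : seq Z) : bool :=
  if 0 <=? plower p then true
  else if depth is depth'.+1 then
    pbisect depth' (pfloor 1 0 p) && pbisect depth' (pfloor 1 0 (preflect p))
  else false.

(* The coefficients are first scaled down so that about 32 significant bits
   remain in the value at the centre of [-1, 1]. *)
Definition pnonneg (p : seq Z) : bool :=
  let s := Z.to_nat (Z.log2 (head 0 p) - 32) in
  let q := pfloor 0 s p in pbisect 8 q && pbisect 8 (pflip q).

(* Fixed-point bounds, in units of [1 / T], of
   [sum_j (y / T)^j / (2 (k + j) + 1)] for [y / T <= 1/2]; the tail of the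
   series is replaced by [0] or [2]. *)
Fixpoint atanh_fix (up : bool) (T : Z) (n k : nat) (y : Z) : Z :=
  if n is n'.+1 then
    T / Z.of_nat (2 * k + 1)%nat + y * atanh_fix up T n' k.+1 y / T
    + (if up then 2 else 0)
  else if up then 2 * T else 0.

(** Based on ln (b / a) = 2 artanh ((b - a) / (b + a)). In the upper bound [c] offsets the two floor
    divisions. *)
Definition ln_fix (up : bool) (T : Z) (n : nat) (a b : Z) : Z :=
  let P := b - a in
  let Q := b + a in
  let c := if up then 1 else 0 in
  2 * P * atanh_fix up T n 0 (T * (P * P) / (Q * Q) + c) / Q + c.

Fixpoint ln_fix_chain (up : bool) (T : Z) (n : nat) (a : Z) (s : seq Z) : Z :=
  if s is b :: s' then ln_fix up T n a b + ln_fix_chain up T n b s' else 0.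

(** For positive [a], a ratio in (1, 2] keeps (b - a) / (b + a) in (0, 1/3], where the artanh series
    converges fast. *)
Definition lt_double (a b : Z) : bool := (a <? b) && (b <=? 2 * a).

(** Powers of two up to 64 suffice: m = c (c - 4) is at most 117 for c <= 13. *)
Definition binary_chain (m : Z) : seq Z :=
  rcons [seq x <- [:: 2; 4; 8; 16; 32; 64] | x <? m] m.

Fixpoint digits_val (s : seq nat) : Z :=
  if s is k :: s' then Z.of_nat k * 10 ^ Z.of_nat (size s') + digits_val s'
  else 0.

(* A polynomial [E (z^2) + z O (z^2)] is given by the pairs of coefficients of
   [E] and [O]. *)
Definition interleave (s : seq (Z * Z)) : seq Z :=
  flatten [seq [:: p.1; p.2] | p <- s].

(* In the coordinate [z = 2 x / c - 1] the two preimages of [z] are opposite,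
   of square [(c - 2 - 2 z) / c]; hence [f (z-) + f (z+)] is twice the even part
   of [f] at that point.  The factor [c ^ size s] clears denominators. *)
Fixpoint branch_sum (c : Z) (s : seq (Z * Z)) : seq Z :=
  if s is p :: s' then
    padd [:: 2 * p.1 * c ^ Z.of_nat (size s)]
         (pmul [:: c - 2; -2] (branch_sum c s'))
  else [::].

(* [B] times [X (F' f - F f') + (A / B) F f] for [X = c - 2 - 2 z], which has
   the sign of the derivative of [ln F - ln f - (A / B) / 2 * ln X]. *)
Definition slope (c A B : Z) (f F : seq Z) : seq Z :=
  padd (pmul f (padd (pscale B (pmul [:: c - 2; -2] (pderiv F))) (pscale A F)))
       (pmul (popp (pderiv f)) (pscale B (pmul [:: c - 2; -2] F))).

(** At z = 1, that is x = c, [m] is the square of the width and b / a is (f (z-) + f (z+)) / f z.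
    The logarithm tests thus place 2 ln (b / a) / ln m between A / B and (A + 1) / B. The last two
    tests say that the logarithmic quotient decreases for the exponent A / B and increases for (A +
    1) / B, so z = 1 is the extremal point in both cases. *)
Definition certificate (T c A B : Z) (s : seq (Z * Z)) : bool :=
  let f := interleave s in
  let F := branch_sum c s in
  let m := c * (c - 4) in
  let N := slope c A B f F in
  let a := c ^ Z.of_nat (size s) * psum f in
  let b := psum F in
  [&& 0 <? T, lt_double a b, 0 <? a, path lt_double 1 (binary_chain m),
      A * ln_fix_chain true T 20 1 (binary_chain m)
        <=? 2 * B * ln_fix false T 20 a b,
      2 * B * ln_fix true T 20 a b
        <=? (A + 1) * ln_fix_chain false T 20 1 (binary_chain m),
      pnonneg (padd [:: -1] f),
      pnonneg (popp N) & pnonneg (padd N (pmul f F))].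

Local Close Scope Z_scope.

(** * Evaluation of integer polynomials at real points *)

Section PolynomialEvaluation.
Context {R : realType}.
Implicit Types (a b : Z) (p q : seq Z) (x y : R).

Definition ZR a : R := (int_of_Z a)%:~R.

Lemma ZRD a b : ZR (Z.add a b) = ZR a + ZR b.
Proof. by rewrite /ZR -[Z.add a b]/(a + b) !rmorphD. Qed.

Lemma ZRM a b : ZR (Z.mul a b) = ZR a * ZR b.
Proof. by rewrite /ZR -[Z.mul a b]/(a * b) !rmorphM. Qed.

Lemma ZRN a : ZR (Z.opp a) = - ZR a.
Proof. by rewrite /ZR -[Z.opp a]/(- a) !rmorphN. Qed.

Lemma ZRB a b : ZR (Z.sub a b) = ZR a - ZR b.
Proof. by rewrite -Z.add_opp_r ZRD ZRN. Qed.

Lemma ZR0 : ZR Z0 = 0. Proof. by []. Qed.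

Lemma ZR1 : ZR (Zpos xH) = 1. Proof. by []. Qed.

Lemma ZR2 : ZR (Zpos (xO xH)) = 2. Proof. by []. Qed.

Lemma ZR_nat n : ZR (Z.of_nat n) = n%:R.
Proof.
by elim: n => // n ih; rewrite Nat2Z.inj_succ -Z.add_1_l ZRD ih mulrS.
Qed.

Lemma ZRX a n : ZR (Z.pow a (Z.of_nat n)) = ZR a ^+ n.
Proof.
elim: n => [//|n ih].
rewrite Nat2Z.inj_succ Z.pow_succ_r; last exact: Nat2Z.is_nonneg.
by rewrite ZRM ih exprS.
Qed.

Lemma ler_ZR a b : Z.leb a b -> ZR a <= ZR b.
Proof.
move=> ab; rewrite /ZR ler_int -subr_ge0 -rmorphB.
have : (0 <= b - a)%R by rewrite subr_ge0.
by case: (b - a) => // p.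
Qed.

Lemma ltr_ZR a b : Z.ltb a b -> ZR a < ZR b.
Proof.
move=> /Z.ltb_lt /Z.le_succ_l /Z.leb_le /ler_ZR; rewrite -Z.add_1_r ZRD.
by apply: lt_le_trans; rewrite ltrDl /ZR.
Qed.

Fixpoint peval p x : R := if p is a :: p' then ZR a + x * peval p' x else 0.

Lemma peval_seq1 a x : peval [:: a] x = ZR a.
Proof. by rewrite /= mulr0 addr0. Qed.

Lemma peval_seq2 a b x : peval [:: a; b] x = ZR a + x * ZR b.
Proof. by rewrite /= mulr0 addr0. Qed.

Lemma pevalD p q x : peval (padd p q) x = peval p x + peval q x.
Proof.
elim: p q => [|a p ih] [|b q] /=; rewrite ?add0r ?addr0//.
by rewrite ZRD ih; ring.
Qed.

Lemma pevalZ k p x : peval (pscale k p) x = ZR k * peval p x.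
Proof. by elim: p => [|a p ih] /=; rewrite ?mulr0// ZRM ih; ring. Qed.

Lemma pevalN p x : peval (popp p) x = - peval p x.
Proof. by elim: p => [|a p ih] /=; rewrite ?oppr0// ZRN ih; ring. Qed.

Lemma pevalM p q x : peval (pmul p q) x = peval p x * peval q x.
Proof.
by elim: p => [|a p ih] /=; rewrite ?mul0r// pevalD pevalZ /= ih ZR0; ring.
Qed.

Lemma peval1 p : peval p 1 = ZR (psum p).
Proof. by elim: p => //= a p ->; rewrite mul1r ZRD. Qed.

Lemma peval_flip p x : peval (pflip p) x = peval p (- x).
Proof. by elim: p => //= a p ih; rewrite pevalN ih; ring. Qed.

Lemma peval_reflect p x : peval (preflect p) x = peval p (1 - x).
Proof.
elim: p => // a p ih.
rewrite -[preflect _]/(padd (padd [:: a] (preflect p))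
  (Z0 :: popp (preflect p))) !pevalD /= pevalN ih ZR0; ring.
Qed.

Lemma peval_cons a p x : peval (pcons a p) x = peval (a :: p) x.
Proof.
by case: p => //=; case: Z.eqb_spec => [->|//]; rewrite /= ZR0 mulr0 addr0.
Qed.

(** Each halving loses at most 1, and the errors of the later halvings are doubled: 1 + 2 (2^s - 1)
    = 2^(s+1) - 1. *)
Lemma quot2_iter_dist s a :
  `|ZR a - 2 ^+ s * ZR (iter s Z.quot2 a)| <= 2 ^+ s - 1.
Proof.
elim: s a => [|s ih] a; first by rewrite expr0 mul1r subrr normr0 subrr.
have a2 : `|ZR a - 2 * ZR (Z.quot2 a)| <= 1.
  rewrite {1}[a]Zquot2_odd_eqn ZRD ZRM ZR2 addrAC subrr add0r.
  by case: Z.odd; case: a => [|a|a]; rewrite /ZR //= ?normr0 ?normrN ?normr1.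
rewrite iterSr; apply: le_trans (ler_distD (2 * ZR (Z.quot2 a)) _ _) _.
have := ih (Z.quot2 a); rewrite -(ler_pM2l (_ : 0 < 2 :> R))//.
rewrite -[X in X * `|_|](@ger0_norm R)// -normrM mulrBr mulrA -exprS => h.
by rewrite !exprS in h *; lra.
Qed.

(** The coefficient of degree j is shifted by s + j e bits, with an error below 2^(s + j e); the
    factor 2^(- j e) in (x / 2^e)^j brings each contribution below 2^s. *)
Lemma ptrunc_dist e s p x : `|x| <= 1 ->
  `|peval p (x / 2 ^+ e) - 2 ^+ s * peval (ptrunc e s p) x| <=
  (size p)%:R * 2 ^+ s.
Proof.
move=> x1; elim: p s => [|a p ih] s /=.
  by rewrite mulr0 subrr normr0 mul0r.
rewrite peval_cons /= -[(size p).+1%:R]natr1 mulrDl mul1r.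
have := ih (s + e)%N; rewrite exprD; have := quot2_iter_dist s a.
set t := peval (ptrunc _ _ _) x; set q := peval p _; set b := ZR (iter _ _ _).
have e0 : 0 < 2 ^+ e :> R by rewrite exprn_gt0.
have s0 : 0 < 2 ^+ s :> R by rewrite exprn_gt0.
move=> hb hq; have -> : ZR a + x / 2 ^+ e * q - 2 ^+ s * (b + x * t) =
    (ZR a - 2 ^+ s * b) + x / 2 ^+ e * (q - 2 ^+ s * 2 ^+ e * t).
  by field; rewrite gt_eqF.
apply: (le_trans (ler_normD _ _)); rewrite addrC lerD//; last by lra.
rewrite normrM normf_div (ger0_norm (ltW e0)).
apply: (@le_trans _ _ (1 / 2 ^+ e * ((size p)%:R * (2 ^+ s * 2 ^+ e)))).
  by apply: ler_pM => //; rewrite ler_pM2r// invr_gt0.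
by rewrite le_eqVlt; apply/orP; left; apply/eqP; field; rewrite gt_eqF.
Qed.

Lemma pfloor_ge0 e s p x : `|x| <= 1 ->
  0 <= peval (pfloor e s p) x -> 0 <= peval p (x / 2 ^+ e).
Proof.
move=> x1; rewrite pevalD /= mulr0 addr0 ZRN ZR_nat => h.
have := ptrunc_dist e s p x1; rewrite ler_norml => /andP[+ _].
have s0 : 0 < 2 ^+ s :> R by rewrite exprn_gt0.
by move: h; rewrite -(pmulr_rge0 _ s0) mulrDr => *; lra.
Qed.

Lemma plower_le p x : 0 <= x <= 1 -> ZR (plower p) <= peval p x.
Proof.
move=> /andP[x0 x1]; elim: p => //= a p ih; rewrite ZRD lerD2l.
set b := plower p in ih *; have := Z.min_spec Z0 b.
have : ZR b <= 0 \/ 0 <= ZR b.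
  by case: (leP (ZR b) 0) => [|/ltW]; [left|right].
move=> b0 [[/Z.lt_le_incl/Z.leb_le/ler_ZR h ->]|[/Z.leb_le/ler_ZR h ->]].
  by rewrite mulr_ge0// (le_trans _ ih).
rewrite ZR0 in h.
by apply: (@le_trans _ _ (x * ZR b)); nra.
Qed.

Lemma pbisect_ge0 n p x : pbisect n p -> 0 <= x <= 1 -> 0 <= peval p x.
Proof.
elim: n p x => [|n ih] p x /=.
  case: ifP => // /ler_ZR; rewrite ZR0 => p0 _ x01.
  exact: le_trans p0 (plower_le _ _).
case: ifP => [/ler_ZR|_]; first rewrite ZR0 => p0 _ x01.
  exact: le_trans p0 (plower_le _ _).
have half q y : pbisect n (pfloor 1 0 q) -> 0 <= y <= 1 -> 0 <= peval q (y / 2).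
  move=> hq y01; rewrite -[2]expr1; apply: pfloor_ge0 (ih _ _ hq y01).
  by rewrite ger0_norm; lra.
move=> /andP[hl hr] x01; have [x2|x2] := leP (2 * x) 1.
  rewrite [x](_ : _ = (2 * x) / 2); last by field.
  by apply: half => //; lra.
rewrite [x](_ : _ = 1 - (2 * (1 - x)) / 2); last by field.
by rewrite -peval_reflect; apply: half => //; lra.
Qed.

Lemma pnonneg_ge0 p x : pnonneg p -> -1 <= x <= 1 -> 0 <= peval p x.
Proof.
move=> /andP[hl hr] x1; rewrite -[x]divr1 -[1](@expr0 _ 2).
apply: pfloor_ge0; first by rewrite ler_norml.
have [x0|x0] := leP 0 x; first by apply: pbisect_ge0 hl _; lra.
by rewrite -[x]opprK -peval_flip; apply: pbisect_ge0 hr _; lra.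
Qed.

#[global] Instance is_derive_peval p x :
  is_derive x 1 (peval p) (peval (pderiv p) x).
Proof.
elim: p => [|a p ih]; first exact: is_derive_cst.
have -> : peval (a :: p) = cst (ZR a) + id * peval p :> (R -> R).
  exact/funext.
have -> : peval (pderiv (a :: p)) x =
    0 + (x *: peval (pderiv p) x + peval p x *: 1).
  by rewrite pevalD /= /GRing.scale /= ZR0; ring.
exact: is_deriveD.
Qed.

Lemma continuous_peval p : continuous (peval p).
Proof. by move=> x; apply/differentiable_continuous/derivable1_diffP. Qed.

Lemma peval_interleave s x : peval (interleave s) x =
  peval (map fst s) (x ^+ 2) + x * peval (map snd s) (x ^+ 2).
Proof.
elim: s => [|p s ih]; rewrite /interleave /= ?mulr0 ?addr0//.
by rewrite -/(interleave s) ih; ring.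
Qed.

Lemma peval_branch_sum c s x y : ZR c * y ^+ 2 = ZR c - 2 - 2 * x ->
  peval (branch_sum c s) x =
  ZR c ^+ size s * (peval (interleave s) (- y) + peval (interleave s) y).
Proof.
move=> hy; rewrite !peval_interleave sqrrN.
elim: s => [|p s ih]; first by rewrite /= !(mulr0, addr0).
have -> : peval (branch_sum c (p :: s)) x = peval (padd
    [:: Z.mul (Z.mul (Zpos (xO xH)) p.1) (Z.pow c (Z.of_nat (size s).+1))]
    (pmul [:: Z.sub c (Zpos (xO xH)); Zneg (xO xH)] (branch_sum c s))) x.
  by [].
rewrite pevalD pevalM peval_seq1 peval_seq2 ih !ZRM ZRX ZRB !ZR2 !map_cons.
have -> : ZR (Zneg (xO xH)) = -2 by [].
have -> : ZR c - 2 + x * - 2 = ZR c * y ^+ 2 by rewrite hy; ring.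
by rewrite [size (p :: s)]/= exprS /=; ring.
Qed.

End PolynomialEvaluation.

(** * The artanh series and its remainder *)

Section Logarithm.
Context {R : realType}.
Implicit Types (x y : R) (f g df dg : R -> R).

Lemma is_derive_nondecreasing f df x y : x <= y ->
  (forall z, x <= z <= y -> is_derive z 1 f (df z)) ->
  (forall z, x <= z <= y -> 0 <= df z) -> f x <= f y.
Proof.
move=> xy fdf df0.
have cf : {within `[x, y], continuous f}.
  apply: derivable_within_continuous => z; rewrite in_itv/= => /fdf h.
  exact: (@ex_derive _ _ _ _ _ _ _ h).
have [|z] := @MVT_segment _ f df x y xy _ cf.
  by move=> z; rewrite in_itv/= => /andP[/ltW ? /ltW ?]; apply: fdf; apply/andP.
by rewrite in_itv/= => /df0 dz e; rewrite -subr_ge0 e mulr_ge0// subr_ge0.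
Qed.

Lemma is_derive_monomial (c : R) n x :
  is_derive x 1 (fun z => c * z ^+ n) (c * (n%:R * x ^+ n.-1)).
Proof.
have dX : is_derive x 1 (id ^+ n : R -> R) ((n%:R * x ^+ n.-1) *: 1).
  exact: is_deriveX.
have := is_deriveZ c dX; rewrite (_ : c \*: _ = (fun z => c * z ^+ n)).
  by rewrite /GRing.scale /= mulr1.
by apply/funext => z; rewrite /= exprfctE.
Qed.

Lemma is_derive_ln_comp g (dg : R) x : 0 < g x -> is_derive x 1 g dg ->
  is_derive x 1 (fun z => ln (g z)) (dg / g x).
Proof.
move=> gx hg; have hl := is_derive1_ln gx.
by rewrite mulrC; exact: (is_derive1_comp (f := @ln R) (g := g)).
Qed.

Lemma is_derive_add f g (a b : R) x : is_derive x 1 f a ->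
  is_derive x 1 g b -> is_derive x 1 (fun z => f z + g z) (a + b).
Proof. exact: is_deriveD. Qed.

Lemma is_derive_sub f g (a b : R) x : is_derive x 1 f a ->
  is_derive x 1 g b -> is_derive x 1 (fun z => f z - g z) (a - b).
Proof. exact: is_deriveB. Qed.

Lemma is_derive_scale (c : R) f (a : R) x : is_derive x 1 f a ->
  is_derive x 1 (fun z => c * f z) (c * a).
Proof. exact: is_deriveZ. Qed.

Fixpoint atanh_sum (k : nat) y : R :=
  if k is k'.+1 then atanh_sum k' y + y ^+ (2 * k' + 1) / (2 * k' + 1)%:R
  else 0.

Definition atanh_rest (k : nat) y : R :=
  (ln (1 + y) - ln (1 - y)) / 2 - atanh_sum k y.

Lemma is_derive_atanh_sum k y : y ^+ 2 != 1 ->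
  is_derive y 1 (atanh_sum k) ((1 - y ^+ (2 * k)) / (1 - y ^+ 2)).
Proof.
move=> y1; have y1' : 1 - y ^+ 2 != 0 by rewrite subr_eq0 eq_sym.
elim: k => [|k ih].
  by rewrite muln0 expr0 subrr mul0r; exact: is_derive_cst.
have -> : atanh_sum k.+1 =
    (fun z => atanh_sum k z + (2 * k + 1)%:R^-1 * z ^+ (2 * k + 1)).
  by apply/funext => z /=; rewrite mulrC.
apply: (is_derive_eq (is_derive_add ih (is_derive_monomial _ _ _))).
have k0 : (2 * k + 1)%:R != 0 :> R by rewrite pnatr_eq0 addn1.
rewrite [in _.-1]addn1 /= mulnS exprD.
move: (_%:R) k0 (y ^+ (2 * k)) => n n0 t; field.
by rewrite y1' n0.
Qed.

(** The derivative 1 / (1 - y^2) of artanh loses a geometric sum. Both bounds of the remainder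
    follow by monotonicity from this formula. *)
Lemma is_derive_atanh_rest k y : -1 < y < 1 ->
  is_derive y 1 (atanh_rest k) (y ^+ (2 * k) / (1 - y ^+ 2)).
Proof.
move=> /andP[y0 y1]; have y2 : y ^+ 2 != 1 by apply/eqP; nra.
have d1 : is_derive y 1 (fun z => ln (1 + z)) (1 / (1 + y)).
  apply: is_derive_ln_comp; first by lra.
  by rewrite -[X in is_derive _ _ _ X]add0r; exact: is_deriveD.
have d2 : is_derive y 1 (fun z => ln (1 - z)) (- 1 / (1 - y)).
  apply: is_derive_ln_comp; first by lra.
  by rewrite -[- 1]add0r; exact: is_deriveB.
have -> : atanh_rest k = (fun z => 2^-1 * (ln (1 + z) - ln (1 - z)) -
    atanh_sum k z) by apply/funext => z; rewrite mulrC.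
apply: (is_derive_eq (is_derive_sub (is_derive_scale _ (is_derive_sub d1 d2))
  (is_derive_atanh_sum k y2))); field.
by apply/and3P; split; apply/eqP; nra.
Qed.

Lemma atanh_rest0 k : atanh_rest k 0 = 0.
Proof.
rewrite /atanh_rest addr0 subr0 subrr mul0r sub0r.
suff -> : atanh_sum k 0 = 0 by rewrite oppr0.
by elim: k => //= k ->; rewrite add0r addn1 expr0n mul0r.
Qed.

Lemma atanh_rest_ge0 k y : 0 <= y < 1 -> 0 <= atanh_rest k y.
Proof.
move=> /andP[y0 y1]; rewrite -(atanh_rest0 k).
apply: (is_derive_nondecreasing y0) => z /andP[z0 zy].
  by apply: is_derive_atanh_rest; apply/andP; split; lra.
by rewrite divr_ge0 ?exprn_ge0//; nra.
Qed.

(** For z^2 <= 1/2 the derivative of the remainder is at most 2 z^(2k), whose primitive is 2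
    z^(2k+1) / (2k+1). The cruder constant 2 is the tail used by [atanh_fix]. *)
Lemma atanh_rest_le k y : 0 <= y -> y ^+ 2 <= 2^-1 ->
  atanh_rest k y <= y ^+ (2 * k + 1) * 2.
Proof.
move=> y0 y2; have := @is_derive_nondecreasing
  (fun z => 2 / (2 * k + 1)%:R * z ^+ (2 * k + 1) - atanh_rest k z)
  (fun z => 2 * z ^+ (2 * k) - z ^+ (2 * k) / (1 - z ^+ 2)) 0 y y0.
have e0 : 0 ^+ (2 * k + 1) = 0 :> R by rewrite addn1 expr0n.
rewrite atanh_rest0 e0 mulr0 subrr subr_ge0 => h.
apply: (le_trans (h _ _)).
- move=> z /andP[z0 zy]; have z1 : -1 < z < 1 by apply/andP; split; nra.
  have k0 : (2 * k + 1)%:R != 0 :> R by rewrite pnatr_eq0 addn1.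
  have dm := is_derive_monomial (2 / (2 * k + 1)%:R) (2 * k + 1) z.
  apply: (is_derive_eq (is_derive_sub dm (is_derive_atanh_rest k z1))).
  by congr (_ - _); rewrite mulrA divfK// addn1.
- move=> z /andP[z0 zy]; have z2 : z ^+ 2 <= 2^-1.
    by apply: le_trans y2; rewrite ler_pXn2r// ?nnegrE.
  have zk : 0 <= z ^+ (2 * k) by rewrite exprn_ge0.
  rewrite subr_ge0 [leRHS]mulrC ler_wpM2l// invf_ple ?posrE//; lra.
rewrite mulrC ler_wpM2l ?exprn_ge0// ler_pdivrMr ?ler_peMr ?ltr0n ?addn1//.
by rewrite ler1n.
Qed.

Lemma atanh_restS k y :
  atanh_rest k y = y ^+ (2 * k + 1) / (2 * k + 1)%:R + atanh_rest k.+1 y.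
Proof. by rewrite /atanh_rest /=; ring. Qed.

Lemma ln_ratioE (a b : R) : 0 < a -> a < b ->
  ln b - ln a = 2 * atanh_rest 0 ((b - a) / (b + a)).
Proof.
move=> a0 ab; rewrite /atanh_rest /= subr0 mulrC divfK//.
have s0 : 0 < b + a by lra.
have -> : 1 + (b - a) / (b + a) = 2 * b / (b + a) by field; rewrite gt_eqF.
have -> : 1 - (b - a) / (b + a) = 2 * a / (b + a) by field; rewrite gt_eqF.
by rewrite !ln_div ?lnM ?posrE ?mulr_gt0//; lra.
Qed.

Lemma ZR_div (a b : Z) : Z.ltb Z0 b ->
  ZR (Z.div a b) <= ZR a / ZR b :> R /\ ZR a / ZR b <= ZR (Z.div a b) + 1 :> R.
Proof.
move=> b0; have b0R : 0 < ZR b :> R by rewrite -[X in X < _]ZR0 ltr_ZR.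
move: b0 => /Z.ltb_lt b0.
rewrite ler_pdivlMr// ler_pdivrMr// -ZR1 -ZRD -!ZRM; split; apply: ler_ZR.
  by rewrite Z.mul_comm; apply/Z.leb_le/Z.mul_div_le.
by rewrite Z.mul_comm; apply/Z.leb_le/Z.lt_le_incl/Z.mul_succ_div_gt.
Qed.

End Logarithm.

(** * Soundness of the fixed-point logarithms *)

Section Certificate.
Context {R : realType}.
Implicit Types (a b c y A B T : Z) (x z : R).

Lemma atanh_fix0 T k y : atanh_fix true T 0 k y = Z.mul (Zpos (xO xH)) T.
Proof. by []. Qed.

Lemma atanh_fixS up T n k y : atanh_fix up T n.+1 k y =
  Z.add (Z.add (Z.div T (Z.of_nat (2 * k + 1)))
               (Z.div (Z.mul y (atanh_fix up T n k.+1 y)) T))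
        (if up then Zpos (xO xH) else Z0).
Proof. by []. Qed.

Lemma ZR_div_ge0 a b : 0 <= ZR a :> R -> Z.ltb Z0 b -> 0 <= ZR (Z.div a b) :> R.
Proof.
move=> a0 b0; have /Z.leb_le/Z.div_pos : Z.leb Z0 a.
  by rewrite /ZR ler0z in a0; case: a a0.
by move=> /(_ b (proj1 (Z.ltb_lt _ _) b0))/Z.leb_le/ler_ZR.
Qed.

Lemma atanh_fix_ge0 up T n k y : Z.ltb Z0 T -> 0 <= ZR y :> R ->
  0 <= ZR (atanh_fix up T n k y) :> R.
Proof.
move=> T0 y0; have T0R : 0 < ZR T :> R by rewrite -[X in X < _]ZR0 ltr_ZR.
elim: n k => [|n ih] k.
  case: up; last exact: lexx.
  by rewrite atanh_fix0 ZRM ZR2 mulr_ge0// ltW.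
rewrite atanh_fixS 2!ZRD; apply: addr_ge0; last by case: (up).
by apply: addr_ge0; apply: ZR_div_ge0; rewrite ?ZRM ?mulr_ge0// ?ltW// addn1.
Qed.

(** Each unfolding matches one term of [atanh_restS], with y / T in place of x^2; floor divisions
    and the zero tail only decrease the value. *)
Lemma atanh_fix_lower T n k y x : Z.ltb Z0 T -> 0 <= ZR y :> R ->
  0 <= x < 1 -> ZR y <= ZR T * x ^+ 2 ->
  x ^+ (2 * k + 1) * ZR (atanh_fix false T n k y) <= ZR T * atanh_rest k x.
Proof.
move=> T0 y0 x1 yx.
have T0R : 0 < ZR T :> R by rewrite -[X in X < _]ZR0 ltr_ZR.
have /andP[x0 _] := x1; elim: n k => [|n ih] k.
  by rewrite mulr0 mulr_ge0 ?atanh_rest_ge0 ?(ltW T0R).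
rewrite atanh_fixS 2!ZRD ZR0 addr0 atanh_restS.
have := ih k.+1; have := @atanh_fix_ge0 false T n k.+1 y T0 y0.
set t := atanh_fix _ _ _ _ _ => t0 it.
have [dt _] := @ZR_div R (Z.mul y t) T T0.
have o0 : Z.ltb Z0 (Z.of_nat (2 * k + 1)) by rewrite addn1.
have [dT _] := @ZR_div R T _ o0; rewrite ZR_nat in dT.
have xk : 0 <= x ^+ (2 * k + 1) by rewrite exprn_ge0.
have {}dt : ZR (Z.div (Z.mul y t) T) <= x ^+ 2 * ZR t.
  apply: (le_trans dt); rewrite ZRM ler_pdivrMr//.
  by rewrite mulrAC ler_wpM2r// mulrC.
apply: (@le_trans _ _
  (x ^+ (2 * k + 1) * (ZR T / (2 * k + 1)%:R + x ^+ 2 * ZR t))).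
  by rewrite ler_wpM2l// lerD.
rewrite [leRHS]mulrDr; apply: le_trans _ (lerD (lexx _) it).
rewrite mulnS -addnA (exprD x 2) le_eqVlt; apply/orP; left; apply/eqP.
by move: ((2 * k + 1)%:R^-1 : R) (x ^+ (2 * k + 1)) => o e; ring.
Qed.

(** The two floor divisions lose at most 1 each, which the added 2 restores; [atanh_rest_le]
    justifies the initial tail. *)
Lemma atanh_fix_upper T n k y x : Z.ltb Z0 T -> 0 <= ZR y :> R ->
  0 <= x -> x ^+ 2 <= 2^-1 -> ZR T * x ^+ 2 <= ZR y ->
  ZR T * atanh_rest k x <= x ^+ (2 * k + 1) * ZR (atanh_fix true T n k y).
Proof.
move=> T0 y0 x0 x1 yx.
have T0R : 0 < ZR T :> R by rewrite -[X in X < _]ZR0 ltr_ZR.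
elim: n k => [|n ih] k.
  rewrite atanh_fix0 ZRM ZR2 mulrA [leRHS]mulrC ler_pM2l//.
  exact: atanh_rest_le.
rewrite atanh_fixS 2!ZRD ZR2 atanh_restS.
have := ih k.+1; have := @atanh_fix_ge0 true T n k.+1 y T0 y0.
set t := atanh_fix _ _ _ _ _ => t0 it.
have [_ dt] := @ZR_div R (Z.mul y t) T T0.
have o0 : Z.ltb Z0 (Z.of_nat (2 * k + 1)) by rewrite addn1.
have [_ dT] := @ZR_div R T _ o0; rewrite ZR_nat in dT.
have xk : 0 <= x ^+ (2 * k + 1) by rewrite exprn_ge0.
have {}dt : x ^+ 2 * ZR t <= ZR (Z.div (Z.mul y t) T) + 1.
  apply: le_trans dt; rewrite ZRM ler_pdivlMr//.
  by rewrite mulrAC ler_wpM2r// mulrC.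
apply: (@le_trans _ _
  (x ^+ (2 * k + 1) * (ZR T / (2 * k + 1)%:R + x ^+ 2 * ZR t))).
  rewrite mulrDr; apply: le_trans (lerD (lexx _) it) _.
  rewrite mulnS -addnA (exprD x 2) le_eqVlt; apply/orP; left; apply/eqP.
  by move: ((2 * k + 1)%:R^-1 : R) (x ^+ (2 * k + 1)) => o e; ring.
by rewrite ler_wpM2l//; lra.
Qed.

Lemma lt_doubleP a b : lt_double a b -> Z.ltb Z0 a -> exists x : R,
  [/\ 0 <= x, x ^+ 2 <= 2^-1, x = (ZR b - ZR a) / (ZR b + ZR a),
      ln (ZR b) - ln (ZR a) = 2 * atanh_rest 0 x &
      Z.ltb Z0 (Z.add b a) && Z.ltb Z0 (Z.mul (Z.add b a) (Z.add b a))].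
Proof.
move=> /andP[ab bR] a0; have {bR} := @ler_ZR R _ _ bR.
have := @ltr_ZR R _ _ a0; have := @ltr_ZR R _ _ ab.
rewrite ZR0 ZRM ZR2 => aR a0R bR; exists ((ZR b - ZR a) / (ZR b + ZR a)).
have s0 : 0 < ZR b + ZR a :> R by rewrite addr_gt0// (lt_trans a0R).
have x3 : (ZR b - ZR a) / (ZR b + ZR a) <= 3^-1 :> R.
  by rewrite ler_pdivrMr//; lra.
have x0 : 0 <= (ZR b - ZR a) / (ZR b + ZR a) :> R.
  by rewrite divr_ge0// ?ltW ?subr_gt0.
split=> //; first by nra.
- exact: ln_ratioE.
- have : Z.lt Z0 (Z.add b a).
    move: ab a0 => /Z.ltb_lt ab /Z.ltb_lt a0.
    by apply: Z.add_pos_pos => //; exact: Z.lt_trans ab.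
  by move=> h; apply/andP; split; apply/Z.ltb_lt => //; apply: Z.mul_pos_pos.
Qed.

Lemma ln_fix_lower T n a b : Z.ltb Z0 T -> Z.ltb Z0 a -> lt_double a b ->
  ZR (ln_fix false T n a b) <= ZR T * (ln (ZR b) - ln (ZR a)) :> R.
Proof.
move=> T0 a0 /lt_doubleP/(_ a0)[x [x0 x2 xE -> /andP[Q0 QQ0]]].
have T0R : 0 < ZR T :> R by rewrite -[X in X < _]ZR0 ltr_ZR.
rewrite /ln_fix !Z.add_0_r; set P := Z.sub b a; set Q := Z.add b a in Q0 QQ0 *.
have PQ : x = ZR P / ZR Q by rewrite xE ZRB ZRD.
have Q0R : 0 < ZR Q :> R by rewrite -[X in X < _]ZR0 ltr_ZR.
set y := Z.div _ (Z.mul Q Q).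
have yT : 0 <= ZR (Z.mul T (Z.mul P P)) :> R.
  by rewrite !ZRM mulr_ge0 ?(ltW T0R)// -expr2 sqr_ge0.
have y0 : 0 <= ZR y :> R by exact: ZR_div_ge0.
have yx : ZR y <= ZR T * x ^+ 2.
  have [+ _] := @ZR_div R (Z.mul T (Z.mul P P)) _ QQ0 => /le_trans; apply.
  rewrite !ZRM PQ le_eqVlt; apply/orP; left; apply/eqP; field.
  by rewrite gt_eqF.
have x1 : 0 <= x < 1 by rewrite x0 /=; nra.
have := @atanh_fix_lower T n 0 y x T0 y0 x1 yx.
set t := atanh_fix _ _ _ _ _; rewrite muln0 expr1 => h.
have [+ _] := @ZR_div R (Z.mul (Z.mul (Zpos (xO xH)) P) t) _ Q0.
move=> /le_trans; apply.
rewrite !ZRM ZR2 (_ : _ / _ = 2 * (x * ZR t)).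
  by rewrite [leRHS]mulrCA ler_pM2l.
by rewrite PQ; field; rewrite gt_eqF.
Qed.

Lemma ln_fix_upper T n a b : Z.ltb Z0 T -> Z.ltb Z0 a -> lt_double a b ->
  ZR T * (ln (ZR b) - ln (ZR a)) <= ZR (ln_fix true T n a b) :> R.
Proof.
move=> T0 a0 /lt_doubleP/(_ a0)[x [x0 x2 xE -> /andP[Q0 QQ0]]].
have T0R : 0 < ZR T :> R by rewrite -[X in X < _]ZR0 ltr_ZR.
rewrite /ln_fix ZRD ZR1; set P := Z.sub b a; set Q := Z.add b a in Q0 QQ0 *.
have PQ : x = ZR P / ZR Q by rewrite xE ZRB ZRD.
have Q0R : 0 < ZR Q :> R by rewrite -[X in X < _]ZR0 ltr_ZR.
set y := Z.add (Z.div _ (Z.mul Q Q)) _.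
have yT : 0 <= ZR (Z.mul T (Z.mul P P)) :> R.
  by rewrite !ZRM mulr_ge0 ?(ltW T0R)// -expr2 sqr_ge0.
have y0 : 0 <= ZR y :> R by rewrite ZRD ZR1 addr_ge0// ZR_div_ge0.
have yx : ZR T * x ^+ 2 <= ZR y.
  rewrite ZRD ZR1.
  have [_ +] := @ZR_div R (Z.mul T (Z.mul P P)) _ QQ0; apply: le_trans.
  rewrite !ZRM PQ le_eqVlt; apply/orP; left; apply/eqP; field.
  by rewrite gt_eqF.
have := @atanh_fix_upper T n 0 y x T0 y0 x0 x2 yx.
set t := atanh_fix _ _ _ _ _; rewrite muln0 expr1 => h.
have [_ +] := @ZR_div R (Z.mul (Z.mul (Zpos (xO xH)) P) t) _ Q0.
apply: le_trans.
rewrite !ZRM ZR2 (_ : _ / _ = 2 * (x * ZR t)).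
  by rewrite [leLHS]mulrCA ler_pM2l.
by rewrite PQ; field; rewrite gt_eqF.
Qed.

Lemma lt_double_gt0 a b : lt_double a b -> Z.ltb Z0 a -> Z.ltb Z0 b.
Proof.
move=> /andP[/Z.ltb_lt ab _] /Z.ltb_lt a0.
by apply/Z.ltb_lt; exact: Z.lt_trans ab.
Qed.

Lemma ln_fix_chain_lower T n a s : Z.ltb Z0 T -> Z.ltb Z0 a ->
  path lt_double a s -> ZR (ln_fix_chain false T n a s) <=
    ZR T * (ln (ZR (last a s)) - ln (ZR a)) :> R.
Proof.
move=> T0; elim: s a => [|b s ih] a a0 /=; first by rewrite subrr mulr0.
move=> /andP[ab bs]; rewrite ZRD.
have b0 := lt_double_gt0 ab a0.
apply: le_trans (lerD (ln_fix_lower n T0 a0 ab) (ih b b0 bs)) _.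
by rewrite le_eqVlt; apply/orP; left; apply/eqP; ring.
Qed.

Lemma ln_fix_chain_upper T n a s : Z.ltb Z0 T -> Z.ltb Z0 a ->
  path lt_double a s -> ZR T * (ln (ZR (last a s)) - ln (ZR a)) <=
    ZR (ln_fix_chain true T n a s) :> R.
Proof.
move=> T0; elim: s a => [|b s ih] a a0 /=; first by rewrite subrr mulr0.
move=> /andP[ab bs]; rewrite ZRD.
have b0 := lt_double_gt0 ab a0.
apply: le_trans _ (lerD (ln_fix_upper n T0 a0 ab) (ih b b0 bs)).
by rewrite le_eqVlt; apply/orP; left; apply/eqP; ring.
Qed.

End Certificate.

(** * Monotonicity of the logarithmic quotient *)

Section LogQuotient.
Context {R : realType}.
Variables (f F df dF : R -> R) (c : R).
Hypothesis c4 : 4 < c.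
Hypotheses (fgt0 : forall z : R, -1 <= z <= 1 -> 0 < f z)
  (Fgt0 : forall z : R, -1 <= z <= 1 -> 0 < F z)
  (fdf : forall z : R, is_derive z 1 f (df z))
  (FdF : forall z : R, is_derive z 1 F (dF z)).
Implicit Types s z : R.

(** For the [F] and [f] of a certificate this is ln (L_s f / f) up to an additive constant, in the
    coordinate z = 2 x / c - 1, where w^2 = c (c - 2 - 2 z). *)
Definition log_quotient s z : R :=
  ln (F z) - ln (f z) - s / 2 * ln (c - 2 - 2 * z).

Definition slope_numerator s z : R :=
  (c - 2 - 2 * z) * (dF z * f z - F z * df z) + s * (F z * f z).

Lemma is_derive_log_quotient s z : -1 <= z <= 1 ->
  is_derive z 1 (log_quotient s)
    (slope_numerator s z / ((c - 2 - 2 * z) * (F z * f z))).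
Proof.
move=> z1; have f0 := fgt0 z1; have F0 := Fgt0 z1.
have X0 : 0 < c - 2 - 2 * z by move: c4 z1 => ? /andP[? ?]; lra.
have dX : is_derive z 1 (fun t => c - 2 - 2 * t) (0 - 2 * 1).
  exact: is_derive_sub (is_derive_cst _ _ _)
    (is_derive_scale _ (is_derive_id _ _)).
rewrite -[log_quotient s]/(fun t => ln (F t) - ln (f t) -
  s / 2 * ln (c - 2 - 2 * t)).
have dF' := @is_derive_ln_comp _ F _ z F0 (FdF z).
have df' := @is_derive_ln_comp _ f _ z f0 (fdf z).
have dX' := @is_derive_ln_comp _ (fun t => c - 2 - 2 * t) _ z X0 dX.
apply: (is_derive_eq (is_derive_sub (is_derive_sub dF' df')
  (is_derive_scale (s / 2) dX'))).
by rewrite /slope_numerator; field; rewrite !gt_eqF.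
Qed.

Lemma log_quotient_ge s z : -1 <= z <= 1 ->
  (forall z, -1 <= z <= 1 -> slope_numerator s z <= 0) ->
  log_quotient s 1 <= log_quotient s z.
Proof.
move=> /andP[z0 z1] N0; rewrite -lerN2.
apply: (@is_derive_nondecreasing _ (fun t => - log_quotient s t)
  (fun t => - (slope_numerator s t / ((c - 2 - 2 * t) * (F t * f t))))) => //.
  move=> t /andP[t0 t1]; apply: is_deriveN; apply: is_derive_log_quotient.
  by apply/andP; split=> //; lra.
move=> t /andP[t0 t1]; have tb : -1 <= t <= 1 by apply/andP; split=> //; lra.
rewrite oppr_ge0 mulr_le0_ge0 ?N0// invr_ge0 !mulr_ge0 ?ltW ?fgt0 ?Fgt0//.
by move: c4 => ?; lra.
Qed.

Lemma log_quotient_le s z : -1 <= z <= 1 ->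
  (forall z, -1 <= z <= 1 -> 0 <= slope_numerator s z) ->
  log_quotient s z <= log_quotient s 1.
Proof.
move=> /andP[z0 z1] N0; apply: (@is_derive_nondecreasing _ (log_quotient s)
  (fun t => slope_numerator s t / ((c - 2 - 2 * t) * (F t * f t)))) => //.
  move=> t /andP[t0 t1]; apply: is_derive_log_quotient.
  by apply/andP; split=> //; lra.
move=> t /andP[t0 t1]; have tb : -1 <= t <= 1 by apply/andP; split=> //; lra.
rewrite divr_ge0 ?N0// !mulr_ge0 ?ltW ?fgt0 ?Fgt0//.
by move: c4 => ?; lra.
Qed.

End LogQuotient.

(** * From a certificate to the two transfer inequalities *)

Section CertificateSound.
Context {R : realType}.
Implicit Types (T c A B : Z) (s : seq (Z * Z)) (w z : R).

Lemma peval_slope c A B f F z : ZR B != 0 :> R ->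
  peval (slope c A B f F) z = ZR B * slope_numerator (peval f) (peval F)
    (peval (pderiv f)) (peval (pderiv F)) (ZR c) (ZR A / ZR B) z.
Proof.
move=> B0; rewrite /slope /slope_numerator pevalD !pevalM pevalD pevalN !pevalZ.
rewrite !pevalM peval_seq2 ZRB ZR2.
by rewrite (_ : ZR (Zneg (xO xH)) = -2)//; field.
Qed.

(** On [-1, 1] the number (c - 2 - 2 z) / c is the square of some y in [0, 1], so F z is a positive
    multiple of f (- y) + f y. *)
Lemma branch_sum_gt0 c s z : 4 < ZR c :> R ->
  (forall t : R, -1 <= t <= 1 -> 0 < peval (interleave s) t) ->
  -1 <= z <= 1 -> 0 < peval (branch_sum c s) z.
Proof.
move=> c4 f0 /andP[z0 z1]; have c0 : 0 < ZR c :> R by lra.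
pose y := Num.sqrt ((ZR c - 2 - 2 * z) / ZR c).
have y2 : y ^+ 2 = (ZR c - 2 - 2 * z) / ZR c.
  by rewrite sqr_sqrtr// divr_ge0//; lra.
have y0 : 0 <= y by exact: sqrtr_ge0.
have y1 : y <= 1.
  by rewrite -(@ler_pXn2r _ 2)// ?nnegrE// expr1n y2 ler_pdivrMr//; lra.
rewrite (@peval_branch_sum _ c s z y); last first.
  by rewrite y2 mulrC divfK// gt_eqF.
by rewrite mulr_gt0 ?exprn_gt0// addr_gt0// f0//; apply/andP; split; lra.
Qed.

(** With w the width at x, the preimages of z are -w / c and w / c, so the conclusions read f <= L_a
    f and L_b f <= f. After taking logarithms, monotonicity reduces each to z = 1, where the
    fixed-point logarithms decide. *)
Lemma certificateP T c A B s : 4 < ZR c :> R -> 0 <= ZR A :> R ->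
  0 < ZR B :> R -> certificate T c A B s ->
  (forall z, -1 <= z <= 1 -> 0 < peval (interleave s) z) /\
  (forall z w, -1 <= z <= 1 -> 0 < w -> w ^+ 2 = ZR c * (ZR c - 2 - 2 * z) ->
    let Lf := peval (interleave s) (- (w / ZR c)) +
              peval (interleave s) (w / ZR c) in
    peval (interleave s) z <= w `^ (- (ZR A / ZR B)) * Lf /\
    w `^ (- ((ZR A + 1) / ZR B)) * Lf <= peval (interleave s) z).
Proof.
move=> c4 A0 B0 /and5P[T0 ab a0 mpath /and5P[lo hi fpos Nneg Npos]].
have one1 : -1 <= (1 : R) <= 1 by lra.
set f := peval (interleave s); set F : R -> R := peval (branch_sum c s).
have fgt0 z : -1 <= z <= 1 -> 0 < f z.
  move=> /(pnonneg_ge0 fpos); rewrite pevalD peval_seq1.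
  by rewrite (_ : ZR (Zneg xH) = -1)// addrC subr_ge0; exact: lt_le_trans.
split=> // z w z1 w0 w2 Lf.
have Fgt0 : forall t, -1 <= t <= 1 -> 0 < F t.
  by move=> t; apply: branch_sum_gt0.
have c0 : 0 < ZR c :> R by lra.
have FL : F z = ZR c ^+ size s * Lf.
  apply: peval_branch_sum; rewrite exprMn w2.
  by rewrite exprVn; field; rewrite gt_eqF.
have Lf0 : 0 < Lf by have := Fgt0 z z1; rewrite FL pmulr_rgt0// exprn_gt0.
have fdf z' : is_derive z' 1 f (peval (pderiv (interleave s)) z').
  exact: is_derive_peval.
have FdF z' : is_derive z' 1 F (peval (pderiv (branch_sum c s)) z').
  exact: is_derive_peval.
have T0R : 0 < ZR T :> R by rewrite -[X in X < _]ZR0 ltr_ZR.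
pose m := Z.mul c (Z.sub c (Zpos (xO (xO xH)))).
have mE : ZR m = ZR c * (ZR c - 4) :> R by rewrite ZRM ZRB.
set a := Z.mul _ (psum _) in ab a0 lo hi; set b := psum _ in ab a0 lo hi.
have aE : ZR a = ZR c ^+ size s * f 1 :> R by rewrite ZRM ZRX -peval1.
have bE : ZR b = F 1 :> R by rewrite -peval1.
have lastm : last (Zpos xH) (binary_chain m) = m by rewrite last_rcons.
have ml := @ln_fix_chain_lower R T 20 (Zpos xH) (binary_chain m) T0 isT mpath.
have mu := @ln_fix_chain_upper R T 20 (Zpos xH) (binary_chain m) T0 isT mpath.
have rl := @ln_fix_lower R T 20 a b T0 a0 ab.
have ru := @ln_fix_upper R T 20 a b T0 a0 ab.
rewrite lastm ZR1 ln1 subr0 in ml mu.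
have := @ler_ZR R _ _ hi; have := @ler_ZR R _ _ lo.
rewrite !ZRM ZRD ZR1 ZR2 => {}lo {}hi; rewrite -/m in lo hi.
have lnm : ln (ZR m) = ln (ZR c) + ln (ZR c - 4) :> R.
  by rewrite mE lnM ?posrE//; lra.
have lna : ln (ZR a) = ln (ZR c ^+ size s) + ln (f 1) :> R.
  by rewrite aE lnM ?posrE// ?exprn_gt0// fgt0.
have lnF : ln (F z) = ln (ZR c ^+ size s) + ln Lf.
  by rewrite FL lnM ?posrE// ?exprn_gt0.
have lnw : ln (ZR c) + ln (ZR c - 2 - 2 * z) = 2 * ln w.
  rewrite -lnM ?posrE// -?w2 ?lnXn ?mulr_natl//.
  by move: z1 => /andP[? ?]; lra.
have c24 : ZR c - 2 - 2 * 1 = ZR c - 4 :> R by ring.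
have wL (s' : R) : 0 < w `^ (- s') * Lf by rewrite mulr_gt0 ?powR_gt0.
have lnwL (s' : R) : ln (w `^ (- s') * Lf) = - s' * ln w + ln Lf.
  by rewrite lnM ?posrE ?powR_gt0// ln_powR.
have lnw' (s' : R) : s' / 2 * (ln (ZR c) + ln (ZR c - 2 - 2 * z)) = s' * ln w.
  by rewrite lnw; field.
split; rewrite -ler_ln ?posrE ?fgt0// lnwL.
- have N0 t : -1 <= t <= 1 -> slope_numerator f F
      (peval (pderiv (interleave s))) (peval (pderiv (branch_sum c s)))
      (ZR c) (ZR A / ZR B) t <= 0.
    move=> t1; rewrite -(pmulr_rle0 _ B0) -peval_slope ?gt_eqF//.
    by rewrite -oppr_ge0 -pevalN pnonneg_ge0.
  have := @log_quotient_ge R f F _ _ (ZR c) c4 fgt0 Fgt0 fdf FdF _ z z1 N0.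
  rewrite /log_quotient c24 lnF.
  have : ZR A / ZR B / 2 * ln (ZR m) <= ln (ZR b) - ln (ZR a) :> R.
    rewrite -(ler_pM2l T0R) -(ler_pM2l B0) -(ler_pM2l (_ : 0 < 2 :> R))//.
    apply: (@le_trans _ _ (2 * ZR B * ZR (ln_fix false T 20 a b))); last first.
      by rewrite -mulrA !ler_pM2l.
    apply: le_trans lo; apply: le_trans _ (ler_wpM2l A0 mu).
    by rewrite le_eqVlt; apply/orP; left; apply/eqP; field; rewrite gt_eqF.
  rewrite lnm lna bE; have := lnw' (ZR A / ZR B).
  by move: (ZR A / ZR B) => s' *; lra.
- have N0 t : -1 <= t <= 1 -> 0 <= slope_numerator f F
      (peval (pderiv (interleave s))) (peval (pderiv (branch_sum c s)))
      (ZR c) ((ZR A + 1) / ZR B) t.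
    move=> t1; rewrite -(pmulr_rge0 _ B0).
    (* Raising the exponent by 1 / B adds exactly F f to the integer slope polynomial. *)
    rewrite (_ : ZR B * _ = peval (padd (slope c A B (interleave s)
        (branch_sum c s)) (pmul (interleave s) (branch_sum c s))) t).
      exact: (pnonneg_ge0 Npos t1).
    rewrite pevalD pevalM peval_slope ?gt_eqF// /slope_numerator -/f -/F.
    by field; rewrite gt_eqF.
  have := @log_quotient_le R f F _ _ (ZR c) c4 fgt0 Fgt0 fdf FdF _ z z1 N0.
  rewrite /log_quotient c24 lnF.
  have : ln (ZR b) - ln (ZR a) <= (ZR A + 1) / ZR B / 2 * ln (ZR m) :> R.
    rewrite -(ler_pM2l T0R) -(ler_pM2l B0) -(ler_pM2l (_ : 0 < 2 :> R))//.
    apply: (@le_trans _ _ (2 * ZR B * ZR (ln_fix true T 20 a b))).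
      by rewrite -mulrA !ler_pM2l.
    apply: (le_trans hi); have A1 : 0 <= ZR A + 1 :> R by lra.
    apply: (le_trans (ler_wpM2l A1 ml)).
    by rewrite le_eqVlt; apply/orP; left; apply/eqP; field; rewrite gt_eqF.
  rewrite lnm lna bE; have := lnw' ((ZR A + 1) / ZR B).
  by move: ((ZR A + 1) / ZR B) => s' *; lra.
Qed.

End CertificateSound.

(** * Covers by intervals and by open sets *)

Section HausdorffCovers.
Context {R : realType}.
Implicit Types (A : set R) (p : R * R) (l : seq (R * R)).

(** The product form accepts the end points in either order, since one of the two branches reverses
    orientation. *)
Definition between p : set R := [set x | 0 <= (p.1 - x) * (x - p.2)].

Lemma between_dist p x y : between p x -> between p y ->
  `|x - y| <= `|p.1 - p.2|.
Proof.
have aux (u v z : R) : 0 <= (u - z) * (z - v) -> u <= v -> u <= z <= v.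
  move=> h uv; have [zu|uz] := ltP z u.
    suff : (u - z) * (z - v) < 0 by lra.
    by rewrite pmulr_rlt0; lra.
  have [vz|//] := ltP v z.
  suff : (u - z) * (z - v) < 0 by lra.
  by rewrite nmulr_rlt0; lra.
move: p => [u v]; rewrite /between /=; have [uv|/ltW vu] := leP u v.
  move=> /aux/(_ uv) hx /aux/(_ uv) hy.
  by rewrite [leRHS]ler0_norm ?ler_norml; [apply/andP; split|]; lra.
rewrite -mulrNN mulrC !opprB => /aux/(_ vu) hx.
rewrite -mulrNN mulrC !opprB => /aux/(_ vu) hy.
by rewrite [leRHS]ger0_norm ?ler_norml; [apply/andP; split|]; lra.
Qed.

Lemma diam_ge0 (U : set R) : U !=set0 -> (0 <= diam U)%E.
Proof.
move=> [x Ux]; apply: ereal_sup_ubound; exists (x, x) => //=.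
by rewrite subrr normr0.
Qed.

Lemma diam_le (U : set R) r : (forall x y, U x -> U y -> `|x - y| <= r) ->
  (diam U <= r%:E)%E.
Proof.
move=> h; apply: ge_ereal_sup => _ [[x y] /= [Ux Uy] <-].
by rewrite lee_fin h.
Qed.

Lemma hausdorff_gauge_ge0 s (U : set R) : (0 <= hausdorff_gauge s U)%E.
Proof. by rewrite /hausdorff_gauge; case: ifP => // _; exact: poweR_ge0. Qed.

Lemma hausdorff_content_ge0 s delta A : (0 <= hausdorff_content s delta A)%E.
Proof.
apply: le_ereal_inf_tmp => _ [U _ <-]; apply: nneseries_ge0 => k _ _.
exact: hausdorff_gauge_ge0.
Qed.

Lemma hausdorff_content_le s delta A l : 0 <= s ->
  (forall x, A x -> exists2 p, p \in l & between p x) ->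
  (forall p, p \in l -> `|p.1 - p.2| <= delta) ->
  (hausdorff_content s delta A <= (\sum_(p <- l) `|p.1 - p.2| `^ s)%:E)%E.
Proof.
move=> s0 cov small.
(* Padding with empty sets costs nothing, as their gauge is 0 even for s = 0. *)
pose U k := if (k < size l)%N then between (nth (0, 0) l k) else set0.
apply: (@le_trans _ _ (\sum_(0 <= k <oo) hausdorff_gauge s (U k))%E).
  apply: ereal_inf_lbound; exists U => //; split=> [x /cov[p pl px]|k].
    exists (index p l) => //=.
    by rewrite /U index_mem pl nth_index.
  rewrite /U; case: ifP => kl; last first.
    by apply: diam_le => x y [].

  apply: diam_le => x y hx hy; apply: le_trans (between_dist hx hy) _.
  by apply: small; exact: mem_nth.
rewrite (@nneseries_split _ _ 0 (size l)); last first.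
  by move=> k _; exact: hausdorff_gauge_ge0.
rewrite add0n [X in (_ + X)%E]eseries0 ?adde0; last first.
  by move=> k kl _; rewrite /U ltnNge kl /= /hausdorff_gauge eqxx.
rewrite (big_nth (0, 0)) -sumEFin !big_mkord; apply: lee_sum => k _.
rewrite /hausdorff_gauge /U ltn_ord; set p := nth _ _ _.
case: ifPn => [_|/set0P p0]; first by rewrite lee_fin powR_ge0.
rewrite -poweR_EFin; apply: gt0_ler_poweR => //.
- by rewrite in_itv /= leey andbT; exact: diam_ge0.
- by rewrite in_itv /= leey andbT lee_fin.
- by apply: diam_le => x y; exact: between_dist.
Qed.

(* The components of [V] are an open set, a bound of its diameter and a bound of
   its gauge. *)
Lemma open_thickening s eta (U : set R) : 0 <= s -> 0 < eta ->
  (diam U <= 1)%E ->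
  exists V : set R * R * R, [/\ open V.1.1, U `<=` V.1.1, 0 < V.1.2,
    (forall x y, V.1.1 x -> V.1.1 y -> `|x - y| <= V.1.2) &
    (V.1.1 !=set0 -> V.1.2 `^ s <= V.2) /\ 0 <= V.2 /\
      (V.2%:E <= hausdorff_gauge s U + eta%:E)%E].
Proof.
move=> s0 eta0 U1; have [->|/set0P U0] := eqVneq U set0.
  exists (set0, 1, 0); split=> //=; split; first by case.
  by rewrite lexx /hausdorff_gauge eqxx add0e lee_fin ltW.
have D0 := diam_ge0 U0; pose D := fine (diam U).
have DE : diam U = D%:E.
  rewrite fineK// fin_numE; apply/andP; split.
    by rewrite gt_eqF// (lt_le_trans _ D0)// ltNy0.
  by rewrite lt_eqF// (le_lt_trans U1)// ltry.
have DU x y : U x -> U y -> `|x - y| <= D.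
  move=> Ux Uy; rewrite -lee_fin -DE; apply: ereal_sup_ubound.
  by exists (x, y).
rewrite DE lee_fin in D0.
(* For s > 0 take r with r^s = D^s + eta; for s = 0 any r > D works. Balls of radius (r - D) / 2
   then raise the diameter bound from D to r. *)
have [r Dr rs] : exists2 r, D < r & r `^ s <= D `^ s + eta.
  have [->|sn0] := eqVneq s 0.
    by exists (D + 1); [lra|rewrite !powRr0; lra].
  have sp : 0 < s by rewrite lt_neqAle eq_sym sn0.
  have e0 : 0 < D `^ s + eta by rewrite ltr_wpDl ?powR_ge0.
  exists ((D `^ s + eta) `^ s^-1); last first.
    by rewrite -powRrM mulVf// powRr1// ltW.
  rewrite -[X in X < _](powRr1 D0) -(mulfV sn0) powRrM.
  by rewrite gt0_ltr_powR ?invr_gt0 ?nnegrE ?powR_ge0 ?ltrDl ?ltW.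
exists (\bigcup_(x in U) ball x ((r - D) / 2), r, D `^ s + eta); split=> /=.
- by apply: bigcup_open => x _; exact: ball_open.
- by move=> x Ux; exists x => //; apply: ballxx; lra.
- lra.
- move=> x y [x' Ux'] + [y' Uy']; rewrite /ball/= => xx yy.
  have := DU _ _ Ux' Uy'; move: xx yy.
  by rewrite !ltr_norml !ler_norml => /andP[? ?] /andP[? ?] /andP[? ?]; lra.
- split=> //; split; first by rewrite addr_ge0 ?powR_ge0 ?ltW.
  rewrite /hausdorff_gauge; case: eqP U0 => [->[]//|_ _].
  by rewrite DE poweR_EFin.
Qed.

End HausdorffCovers.

(** * Geometry of the inverse branches *)

Section Branches.
Context {R : realType}.
Implicit Types (c s x y : R) (e : bool) (g h : R -> R).

Definition width c x : R := Num.sqrt (c ^+ 2 - 4 * x).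

Definition branch c e x : R := (c + (-1) ^+ e * width c x) / 2.

Definition transfer c s g x : R :=
  width c x `^ (- s) * (g (branch c true x) + g (branch c false x)).

Variable c : R.
Hypothesis c5 : 5 <= c.

(** The least width on [0, c]. It exceeds 1 because c >= 5, and both branches contract distances by
    a factor of at least [kappa]. *)
Let kappa : R := width c c.

Lemma width_sqr x : 0 <= x <= c -> width c x ^+ 2 = c ^+ 2 - 4 * x.
Proof. by move: c5 => ? /andP[x0 xc]; rewrite sqr_sqrtr; nra. Qed.

Lemma width_anti x y : x <= y -> width c y <= width c x.
Proof. by move=> xy; apply: ler_wsqrtr; lra. Qed.

Lemma width_gt1 : 1 < kappa.
Proof.
move: c5 => ?; rewrite -[X in X < _]sqrtr1 ltr_sqrt; nra.
Qed.

Lemma width_ge x : 0 <= x <= c -> kappa <= width c x.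
Proof. by move=> /andP[_ xc]; exact: width_anti. Qed.

Lemma width_gt0 x : 0 <= x <= c -> 0 < width c x.
Proof. by move=> /width_ge; apply: lt_le_trans; have := width_gt1; lra. Qed.

Lemma width_le x : 0 <= x <= c -> width c x <= c.
Proof.
move=> /andP[x0 _]; apply: (le_trans (width_anti x0)).
by rewrite /width mulr0 subr0 sqrtr_sqr ger0_norm//; move: c5; lra.
Qed.

Lemma branch_itv e x : 0 <= x <= c -> 0 <= branch c e x <= c.
Proof.
move=> xc; have := width_le xc; have := width_gt0 xc; rewrite /branch.
by case: e => /= *; apply/andP; split; rewrite ?expr1 ?expr0; lra.
Qed.

Lemma branchB e x y :
  branch c e x - branch c e y = (-1) ^+ e * (width c x - width c y) / 2.
Proof. by rewrite /branch; field. Qed.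

Lemma width_diff x y : 0 <= x <= c -> 0 <= y <= c ->
  (width c x - width c y) * (width c x + width c y) = 4 * (y - x).
Proof. by move=> xc yc; rewrite -subr_sqr !width_sqr//; ring. Qed.

Lemma branch_dist e x y :
  `|branch c e x - branch c e y| = `|width c x - width c y| / 2.
Proof. by rewrite branchB !normrM normr_sign mul1r [`|2^-1|]ger0_norm. Qed.

(** The squares of the widths differ by 4 (y - x), so the exact contraction factor is the mean of
    the two widths. *)
Lemma branch_distM e x y : 0 <= x <= c -> 0 <= y <= c ->
  `|x - y| = `|branch c e x - branch c e y| * ((width c x + width c y) / 2).
Proof.
move=> xc yc; have s0 : 0 < width c x + width c y.
  by rewrite addr_gt0// width_gt0.
have /(congr1 Num.norm) := width_diff xc yc.
rewrite !normrM (ger0_norm (ltW s0)) (@ger0_norm _ 4)// branch_dist.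
by rewrite [`|y - x|]distrC => h; lra.
Qed.

End Branches.

(** * Upper bound of the dimension by refined covers *)

Section UpperBound.
Context {R : realType}.
Variables (c b : R) (f : R -> R) (J : set R).
Hypotheses (c5 : 5 <= c) (b0 : 0 <= b) (b1 : b < 1)
  (f_cont : continuous f)
  (f_gt0 : forall x : R, 0 <= x <= c -> 0 < f x)
  (f_super : forall x : R, 0 <= x <= c -> transfer c b f x <= f x)
  (J_itv : forall x : R, J x -> 0 <= x <= c)
  (J_inv : J = branch c true @` J `|` branch c false @` J).
Implicit Types (p : R * R) (l : seq (R * R)).

Let kappa : R := width c c.

Definition branch_pair (e : bool) p := (branch c e p.1, branch c e p.2).

Definition refine l : seq (R * R) :=
  map (branch_pair true) l ++ map (branch_pair false) l.

(** The sign of the branch is squared away, and the product of the width differences has the sign of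
    (p.1 - x) (x - p.2) by [width_diff]. *)
Lemma between_branch e p x : 0 <= p.1 <= c -> 0 <= p.2 <= c -> 0 <= x <= c ->
  between p x -> between (branch_pair e p) (branch c e x).
Proof.
move=> uc vc xc; rewrite /between /= !branchB.
have := width_diff c5 uc xc; have := width_diff c5 xc vc.
have := width_gt0 c5 uc; have := width_gt0 c5 vc; have := width_gt0 c5 xc.
move: (width c p.1) (width c p.2) (width c x) => wu wv w w0 wv0 wu0 h1 h2 h.
have -> : (-1) ^+ e * (wu - w) / 2 * ((-1) ^+ e * (w - wv) / 2) =
    (wu - w) * (w - wv) / 4.
  have -> : (-1) ^+ e * (wu - w) / 2 * ((-1) ^+ e * (w - wv) / 2) =
    ((-1) ^+ e) ^+ 2 * ((wu - w) * (w - wv) / 4) by field.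
  by rewrite sqrr_sign mul1r.
rewrite divr_ge0// -(pmulr_rge0 _ (_ : 0 < (wu + w) * (w + wv))); last first.
  by rewrite mulr_gt0// addr_gt0.
have -> : (wu + w) * (w + wv) * ((wu - w) * (w - wv)) =
  ((wu - w) * (wu + w)) * ((w - wv) * (w + wv)) by ring.
by rewrite h1 h2; nra.
Qed.

Lemma refine_sub n p : p \in iter n refine [:: (0, c)] ->
  [/\ 0 <= p.1 <= c, 0 <= p.2 <= c & `|p.1 - p.2| <= c / kappa ^+ n].
Proof.
have k1 := width_gt1 c5; rewrite -/kappa in k1.
elim: n p => [|n ih] p /=.
  rewrite inE => /eqP -> /=; rewrite sub0r normrN expr0 divr1.
  by rewrite ger0_norm; [split|]; move: c5 => *; lra.
have aux e q : q \in iter n refine [:: (0, c)] -> let p := branch_pair e q in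
    [/\ 0 <= p.1 <= c, 0 <= p.2 <= c & `|p.1 - p.2| <= c / kappa ^+ n.+1].
  move=> /ih [uc vc uv] /=; split; [exact: branch_itv..|].
  rewrite exprSr invfM mulrA ler_pdivlMr; last by lra.
  apply: le_trans uv; rewrite (branch_distM c5 e uc vc) ler_wpM2l//.
  have := width_ge uc; have := width_ge vc; rewrite -/kappa => *; lra.
by rewrite mem_cat => /orP[] /mapP[q ql ->]; exact: aux.
Qed.

Lemma refine_cover n x : J x ->
  exists2 p, p \in iter n refine [:: (0, c)] & between p x.
Proof.
elim: n x => [|n ih] x Jx.
  exists (0, c); first by rewrite inE.
  by have := J_itv Jx; rewrite /between /= => /andP[? ?]; nra.
have aux e y : J y -> exists2 p, p \in iter n.+1 refine [:: (0, c)] &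
    between p (branch c e y).
  move=> /[dup] /J_itv yc /ih[p pl py]; have [uc vc _] := refine_sub pl.
  exists (branch_pair e p); last exact: between_branch.
  by rewrite /= mem_cat; case: e; rewrite map_f ?orbT.
by move: Jx; rewrite {1}J_inv => -[] [y /aux h <-].
Qed.

(** Evaluating [f] at the first end point makes the sum over the two children a transfer operator
    applied at [p.1]. *)
Definition weight s p : R := `|p.1 - p.2| `^ s * f p.1.

(* The factor [1 / (1 - t)] accounts for the distortion of the branches on short
   intervals. *)
Lemma weight_branch s t p : b <= s <= 1 -> 0 <= t < 1 ->
  0 <= p.1 <= c -> 0 <= p.2 <= c -> `|p.1 - p.2| <= t * kappa ^+ 2 ->
  weight s (branch_pair true p) + weight s (branch_pair false p) <=
  kappa `^ (- (s - b)) / (1 - t) * weight s p.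
Proof.
move=> /andP[bs s1] /andP[t0 t1] uc vc uv.
have s0 : 0 <= s by exact: le_trans bs.
have k1 := width_gt1 c5; rewrite -/kappa in k1.
have wu := width_ge uc; have wv := width_ge vc; rewrite -/kappa in wu wv.
pose q := (width c p.1 + width c p.2) / 2.
have kq : kappa <= q by rewrite /q; lra.
have q0 : 0 < q by lra.
have t10 : 0 < 1 - t by lra.
have dE e : `|branch c e p.1 - branch c e p.2| = `|p.1 - p.2| / q.
  by rewrite (branch_distM c5 e uc vc) mulfK// gt_eqF.
(* The widths at the two ends differ by twice the length of a child, which is at most t kappa^2 / q
   <= t [width c p.1]. *)
have qw : width c p.1 * (1 - t) <= q.
  have : `|width c p.1 - width c p.2| <= 2 * (t * width c p.1).
    rewrite -ler_pdivrMl// mulrC -(branch_dist _ true) dE ler_pdivrMr//.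
    apply: (le_trans uv); rewrite -mulrA ler_wpM2l// expr2 ler_pM//; lra.
  rewrite ler_norml => /andP[_ h]; rewrite /q; lra.
have qs : q^-1 `^ s <= width c p.1 `^ (- b) * (kappa `^ (- (s - b)) / (1 - t)).
  have w0 : 0 < width c p.1 by lra.
  have wt : 0 < width c p.1 * (1 - t) by rewrite mulr_gt0.
  apply: (@le_trans _ _ ((width c p.1 * (1 - t))^-1 `^ s)).
    apply: ge0_ler_powR => //; rewrite ?nnegrE ?invr_ge0 ?(ltW q0) ?(ltW wt)//.
    by rewrite lef_pV2 ?posrE.
  rewrite invfM powRM ?invr_ge0 ?(ltW w0) ?(ltW t10)//.
  rewrite -[(width c p.1)^-1]powR_inv1 ?(ltW w0)// -powRrM mulN1r.
  rewrite mulrA ler_pM ?powR_ge0//.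
    rewrite (_ : - s = - b + - (s - b)); last by ring.
    rewrite powRD; last by apply/implyP => _; rewrite gt_eqF.
    rewrite ler_wpM2l ?powR_ge0// !powRN.
    rewrite lef_pV2 ?posrE ?powR_gt0//; last by lra.
    by apply: ge0_ler_powR; rewrite ?nnegrE; lra.
  (* Since s <= 1, the distortion (1 - t)^(-s) is at most 1 / (1 - t). *)
  rewrite -[leRHS]powRr1 ?invr_ge0 ?(ltW t10)//; apply: ler_powR => //.
  by rewrite -invr1 lef_pV2 ?posrE//; lra.
rewrite /weight /branch_pair /= !dE -mulrDr powRM ?invr_ge0 ?(ltW q0)//.
have fsum : 0 <= f (branch c true p.1) + f (branch c false p.1).
  by rewrite addr_ge0// ltW// f_gt0// branch_itv.
rewrite mulrCA -mulrA; apply: ler_wpM2l; first exact: powR_ge0.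
apply: (le_trans (ler_wpM2r fsum qs)); rewrite mulrAC mulrC; apply: ler_wpM2l.
  by rewrite divr_ge0 ?powR_ge0// ltW.
exact: f_super.
Qed.

Lemma expr_eventually_le (z e : R) : 0 <= z < 1 -> 0 < e ->
  exists N, forall n, (N <= n)%N -> z ^+ n <= e.
Proof.
move=> /andP[z0 z1] e0; have z1' : `|z| < 1 by rewrite ger0_norm.
have /cvgrPdist_le/(_ _ e0)[N _ h] := cvg_expr z1'.
exists N => n /h /=; rewrite sub0r normrN; apply: le_trans.
exact: ler_norm.
Qed.

Lemma weight_refine s t n : b <= s <= 1 -> 0 <= t < 1 ->
  c / kappa ^+ n <= t * kappa ^+ 2 ->
  \sum_(p <- iter n.+1 refine [:: (0, c)]) weight s p <=
  kappa `^ (- (s - b)) / (1 - t) *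
  \sum_(p <- iter n refine [:: (0, c)]) weight s p.
Proof.
move=> sb t1 nt; rewrite iterS /refine big_cat !big_map /= -big_split /=.
rewrite mulr_sumr big_seq [leRHS]big_seq; apply: ler_sum => p pl.
have [uc vc uv] := refine_sub pl.
by apply: weight_branch => //; exact: le_trans uv nt.
Qed.

Lemma hausdorff_measure_eq0 s : b < s -> s <= 1 -> hausdorff_measure s J = 0%E.
Proof.
move=> bs s1; have s0 : 0 <= s by move: b0; lra.
have k1 := width_gt1 c5; rewrite -/kappa in k1; have k0 : 0 < kappa by lra.
have ck : 0 < c by move: c5; lra.
(* With this [t] the rate th / (1 - t) = 2 th / (1 + th) remains below 1 despite the distortion. *)
pose th := kappa `^ (- (s - b)); pose t := (1 - th) / 2.
have th0 : 0 < th by rewrite powR_gt0.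
have th1 : th < 1.
  rewrite /th powRN invf_lt1 ?powR_gt0//.
  rewrite -[X in X < _](powRr0 kappa) lt_neqAle ler_powR ?ltW ?subr_gt0// andbT.
  rewrite powRr0 eq_sym powR_eq1 !negb_or gt_eqF// -leNgt ltW//=.
  by rewrite subr_eq0 gt_eqF.
have t1 : 0 <= t < 1 by rewrite /t; apply/andP; split; lra.
have t0 : 0 < t by rewrite /t; lra.
pose th' := th / (1 - t).
have th'1 : 0 <= th' < 1.
  rewrite /th' divr_ge0 ?ltW//=; last by move: t1 => /andP[]; lra.
  by rewrite ltr_pdivrMr /t; lra.
have [x0 x0c fmin] : exists2 x0, x0 \in `[0, c] &
    forall y, y \in `[0, c] -> f x0 <= f y.
  apply: EVT_min; first exact: ltW.
  exact: continuous_subspaceT.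
have m0 : 0 < f x0 by apply: f_gt0; rewrite in_itv in x0c.
have ki : 0 <= kappa^-1 < 1.
  by rewrite invr_ge0 ltW//= invf_lt1.
have small e : 0 < e -> exists N, forall n, (N <= n)%N -> c / kappa ^+ n <= e.
  move=> e0; have ec : 0 < e / c by rewrite divr_gt0.
  have [N h] := expr_eventually_le ki ec.
  exists N => n /h; rewrite exprVn => hn.
  by rewrite mulrC -ler_pdivlMr.
have [N0 hN0] := small (t * kappa ^+ 2) (mulr_gt0 t0 (exprn_gt0 _ k0)).
pose W n := \sum_(p <- iter n refine [:: (0, c)]) weight s p.
have Wn n : W (N0 + n)%N <= th' ^+ n * W N0.
  elim: n => [|n ih]; first by rewrite addn0 expr0 mul1r.
  rewrite addnS exprS -mulrA; apply: le_trans (_ : _ <= th' * W (N0 + n)%N) _.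
    apply: weight_refine => //; first by rewrite ltW.
    by apply: hN0; exact: leq_addr.
  by rewrite ler_wpM2l//; case/andP: th'1.
have W0 : 0 <= W N0.
  rewrite /W big_seq sumr_ge0// => p /refine_sub[uc _ _].
  by rewrite mulr_ge0 ?powR_ge0// ltW// f_gt0.
have content0 delta : 0 < delta -> hausdorff_content s delta J = 0%E.
  move=> d0; apply/eqP; rewrite eq_le hausdorff_content_ge0 andbT.
  apply/lee_addgt0Pr => e e0; rewrite add0e.
  have [N1 hN1] := small delta d0.
  have e'0 : 0 < e * f x0 / (W N0 + 1).
    by rewrite divr_gt0 ?mulr_gt0// ltr_wpDl.
  have [N2 hN2] := expr_eventually_le th'1 e'0.
  (* [N0] makes the intervals short enough for the distortion bound, [N1] makes them shorter than
     [delta], and [N2] brings the decay below the target. *)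
  pose n := (N0 + (N1 + N2))%N.
  apply: (@le_trans _ _
    (\sum_(p <- iter n refine [:: (0, c)]) `|p.1 - p.2| `^ s)%:E).
    apply: hausdorff_content_le => // [x Jx|p pl]; first exact: refine_cover.
    have [_ _ /le_trans] := refine_sub pl; apply.
    by apply: hN1; rewrite /n addnCA leq_addr.
  rewrite lee_fin -(ler_pM2l m0).
  apply: (@le_trans _ _ (W n)).
    rewrite /W mulr_sumr big_seq [leRHS]big_seq; apply: ler_sum => p pl.
    have [uc _ _] := refine_sub pl.
    by rewrite mulrC ler_wpM2l ?powR_ge0// fmin// in_itv.
  apply: (le_trans (Wn _)).
  apply: (@le_trans _ _ (e * f x0 / (W N0 + 1) * W N0)).
    by rewrite ler_wpM2r// hN2// leq_addl.
  rewrite mulrAC ler_pdivrMr; last by rewrite ltr_wpDl.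
  rewrite [f x0 * e]mulrC ler_wpM2l ?mulr_ge0 ?ltW//; lra.
rewrite /hausdorff_measure (_ : [set _ | _ in _] = [set 0%E]) ?ereal_sup1//.
apply/seteqP; split=> [_ [delta /= d0 <-]|_ ->]; first by rewrite content0.
by exists 1 => /=; rewrite ?content0.
Qed.

Lemma hausdorff_dim_le : (hausdorff_dim J <= b%:E)%E.
Proof.
apply/lee_addgt0Pr => e e0; rewrite -EFinD.
(* The cap at 1 is what [hausdorff_measure_eq0] asks for; b < 1 leaves room below it. *)
pose s := Num.min 1 (b + e).
have [bs s1] : b < s /\ s <= 1.
  by rewrite /s lt_min ge_min lexx b1 ltrDl e0.
apply: (@le_trans _ _ s%:E); last by rewrite lee_fin /s ge_min lexx orbT.
apply: ereal_inf_lbound; exists s => //; split.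
  by rewrite (le_trans b0)// ltW.
exact: hausdorff_measure_eq0.
Qed.

End UpperBound.

(** * Iterates of the transfer operator *)

Section Transfer.
Context {R : realType}.
Implicit Types (c s x k : R) (g h : R -> R) (K : set R).

(** Iterates at a point of [K] only see values on [K] when the branches preserve it. This serves
    both for [0, c] and for the Julia set. *)
Lemma transfer_iter_le c s K g h n x :
  (forall e y, K y -> K (branch c e y)) -> (forall y, K y -> g y <= h y) ->
  K x -> iter n (transfer c s) g x <= iter n (transfer c s) h x.
Proof.
move=> Kb gh; elim: n x => [|n ih] x Kx /=; first exact: gh.
by rewrite ler_wpM2l ?powR_ge0// lerD// ih//; exact: Kb.
Qed.

Lemma transfer_iterZ c s k g n x :
  iter n (transfer c s) (fun y => k * g y) x = k * iter n (transfer c s) g x.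
Proof. by elim: n x => //= n ih x; rewrite /transfer !ih; ring. Qed.

Lemma transfer_iter_sum c s (I : Type) (r : seq I) (F : I -> R -> R) n x :
  iter n (transfer c s) (fun y => \sum_(i <- r) F i y) x =
  \sum_(i <- r) iter n (transfer c s) (F i) x.
Proof.
elim: n x => //= n ih x.
by rewrite /transfer !ih -big_split mulr_sumr.
Qed.

Lemma transfer_iter0 c s n x : iter n (transfer c s) (fun=> 0) x = 0 :> R.
Proof. by elim: n x => //= n ih x; rewrite /transfer !ih addr0 mulr0. Qed.

End Transfer.

(** * Lower bound of the dimension by mass distribution *)

Section LowerBound.
Context {R : realType}.
Variables (c a : R) (f : R -> R) (J : set R).
Hypotheses (c5 : 5 <= c) (a1 : a <= 1)
  (f_cont : continuous f)
  (f_gt0 : forall x : R, 0 <= x <= c -> 0 < f x)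
  (f_sub : forall x : R, 0 <= x <= c -> f x <= transfer c a f x)
  (J_itv : forall x : R, J x -> 0 <= x <= c)
  (J_closed : closed J) (J0 : J !=set0)
  (J_branch : forall e x, J x -> J (branch c e x)).

Let kappa : R := width c c.

Let itv_branch e x : [set x | 0 <= x <= c] x ->
  [set x | 0 <= x <= c] (branch c e x).
Proof. exact: branch_itv. Qed.

Section Exponent.
Variable s : R.
Hypotheses (s0 : 0 <= s) (sa : s < a).

Let Theta : R := kappa `^ (a - s).
(** Chosen so that (kappa + 2 delta0) / (kappa - 2 delta0) = Theta: below this size the distortion
    of one step is paid for by the gain [Theta]. *)
Let delta0 : R := kappa * (Theta - 1) / (2 * (Theta + 1)).

Let kappa1 : 1 < kappa. Proof. exact: width_gt1. Qed.

Let Theta1 : 1 < Theta.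
Proof.
have k1 := kappa1; have sa' := sa.
rewrite /Theta lt_neqAle -[X in X <= _](powRr0 kappa).
rewrite ler_powR ?(ltW k1)//; last by lra.
rewrite andbT eq_sym powR_eq1 !negb_or gt_eqF// -leNgt.
by rewrite ltW ?subr_eq0 ?gt_eqF//=; lra.
Qed.

Let delta0_gt0 : 0 < delta0.
Proof.
have k1 := kappa1; have t1 := Theta1.
by rewrite /delta0 divr_gt0// mulr_gt0//; lra.
Qed.

Let delta0_lt : 2 * delta0 < kappa.
Proof.
have k1 := kappa1; have t1 := Theta1.
rewrite /delta0 mulrA ltr_pdivrMr; last by lra.
by nra.
Qed.

(** Pointwise L_s f = w^(a - s) L_a f, with w at least [kappa] and a - s positive. *)
Lemma transfer_gain x : 0 <= x <= c -> Theta * f x <= transfer c s f x.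
Proof.
move=> xc; have wk := width_ge xc; have w0 := width_gt0 c5 xc.
rewrite -/kappa in wk; have k1 := kappa1; have sa' := sa.
have fsum : 0 <= f (branch c true x) + f (branch c false x).
  by rewrite addr_ge0// ltW// f_gt0// branch_itv.
apply: (@le_trans _ _ (Theta * transfer c a f x)).
  by rewrite ler_wpM2l ?powR_ge0// f_sub.
rewrite /transfer mulrA ler_wpM2r//.
rewrite (_ : - s = (a - s) + - a); last by ring.
rewrite powRD; last by apply/implyP => _; rewrite gt_eqF.
by rewrite ler_wpM2r ?powR_ge0// ge0_ler_powR ?nnegrE//; lra.
Qed.

(** Points on different branches are (w + w') / 2 >= kappa apart, so a set of smaller diameter meets
    only one branch. *)
Lemma same_branch (V : set R) r e e' y z : r < kappa ->
  (forall y z, V y -> V z -> `|y - z| <= r) -> 0 <= y <= c -> 0 <= z <= c ->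
  V (branch c e y) -> V (branch c e' z) -> e = e'.
Proof.
move=> rk Vr yc zc Vy Vz.
have wy := width_ge yc; have wz := width_ge zc; rewrite -/kappa in wy wz.
have := Vr _ _ Vy Vz; have := Vr _ _ Vz Vy; rewrite !ler_norml /branch.
case: e e' {Vy Vz} => [] [] //= /andP[_ h1] /andP[_ h2]; exfalso;
  rewrite !expr1 !expr0 in h1 h2; lra.
Qed.

Definition preimage_branches (V : set R) : set R :=
  [set y | 0 <= y <= c /\ exists e, V (branch c e y)].

(** All points of the preimage enter [V] by the same branch, and their widths differ from that at
    [y0] by at most 2 r. This controls both the expansion of distances and the factor w^(-s). *)
Lemma transfer_indic_le (V : set R) r y0 : 0 < r -> r < delta0 ->
  (forall y z, V y -> V z -> `|y - z| <= r) -> preimage_branches V y0 ->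
  (forall y z, preimage_branches V y -> preimage_branches V z ->
    `|y - z| <= (width c y0 + 2 * r) * r) /\
  (forall y, 0 <= y <= c -> transfer c s \1_V y <=
    (width c y0 - 2 * r) `^ (- s) * \1_(preimage_branches V) y).
Proof.
move=> r0 rd Vr [y0c [e0 Vy0]]; have d2 := delta0_lt.
have rk : r < kappa by lra.
have wy0 := width_ge y0c; rewrite -/kappa in wy0.
have close y e : 0 <= y <= c -> V (branch c e y) ->
    `|width c y - width c y0| <= 2 * r.
  move=> yc Vy; have := Vr _ _ Vy Vy0.
  rewrite (same_branch rk Vr yc y0c Vy Vy0) branch_dist; lra.
split.
  move=> y z [yc [e Vy]] [zc [e' Vz]].
  have ee := same_branch rk Vr yc zc Vy Vz.
  rewrite (branch_distM c5 e yc zc) mulrC ler_pM//; last first.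
  - by rewrite {2}ee; exact: Vr.
  - have := close _ _ yc Vy; have := close _ _ zc Vz.
    by rewrite !ler_norml => /andP[? ?] /andP[? ?]; lra.
  - by have := width_gt0 c5 yc; have := width_gt0 c5 zc; lra.
move=> y yc; rewrite /transfer; have [yV|yV] := pselect (preimage_branches V y).
  have [_ [e Vy]] := yV.
  have -> : \1_V (branch c true y) + \1_V (branch c false y) = 1 :> R.
    rewrite !indicE; have Vne : ~ V (branch c (~~ e) y).
      by move=> Vne; have := same_branch rk Vr yc yc Vy Vne; case: (e).
    move: Vy Vne; case: e => /= Vy Vne.
      by rewrite (mem_set Vy) memNset ?addr0.
    by rewrite (mem_set Vy) memNset ?add0r.
  rewrite indicE mem_set// !mulr1 !powRN.
  have := close _ _ yc Vy; rewrite ler_norml => /andP[h _].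
  have wm : 0 < width c y0 - 2 * r by lra.
  have wy : 0 < width c y by exact: width_gt0.
  rewrite lef_pV2 ?posrE ?powR_gt0//.
  by rewrite ge0_ler_powR ?nnegrE ?(ltW wm) ?(ltW wy)//; lra.
have -> : \1_V (branch c true y) + \1_V (branch c false y) = 0 :> R.
  rewrite !indicE !memNset ?addr0// => Vy; apply: yV.
    by split=> //; exists false.
  by split=> //; exists true.
by rewrite mulr0 mulr_ge0 ?powR_ge0.
Qed.

Variables (m0 : R).
Hypotheses (m0_gt0 : 0 < m0) (m0_le : forall x : R, 0 <= x <= c -> m0 <= f x).

(** Makes 1 <= C r^s f hold on [0, c] as soon as r >= delta0, which settles the large sets. *)
Let C : R := (delta0 `^ s * m0)^-1.

Lemma transfer_iter_gt0 n x : 0 <= x <= c -> 0 < iter n (transfer c s) f x.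
Proof.
elim: n x => [|n ih] x xc /=; first exact: f_gt0.
by rewrite mulr_gt0 ?powR_gt0 ?width_gt0// addr_gt0// ih// branch_itv.
Qed.

(* By induction on [n], replacing [V] by its preimage under the branches, whose
   diameter is at most [M r] while [L_s 1_V <= m^(-s) 1_V']; the gain [Theta] of
   [L_s f] over [f] pays for the distortion [M / m]. *)
Lemma transfer_iter_indic_le n (V : set R) r x : 0 < r ->
  (forall y z, V y -> V z -> `|y - z| <= r) -> delta0 <= kappa ^+ n * r ->
  0 <= x <= c ->
  iter n (transfer c s) \1_V x <= C * r `^ s * iter n (transfer c s) f x.
Proof.
have d0 := delta0_gt0; have d2 := delta0_lt.
have k1 := kappa1; have t1 := Theta1.
have C0 : 0 < C by rewrite invr_gt0 mulr_gt0 ?powR_gt0.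
have fn m y (yc : 0 <= y <= c) := ltW (transfer_iter_gt0 m yc).
have large m (U : set R) t : delta0 <= t -> 0 <= x <= c ->
    iter m (transfer c s) \1_U x <= C * t `^ s * iter m (transfer c s) f x.
  move=> dt xc; rewrite -transfer_iterZ.
  apply: (@transfer_iter_le _ c s _ _ _ _ _ itv_branch) => // y yc.
  apply: (@le_trans _ _ 1); first by rewrite indicE lern1 leq_b1.
  rewrite /C -mulrA ler_pdivlMl ?mulr_gt0 ?powR_gt0// mulr1.
  rewrite ler_pM ?powR_ge0 ?(ltW m0_gt0)// ?m0_le//.
  by rewrite ge0_ler_powR// nnegrE; lra.
elim: n V r => [|n ih] V r r0 Vr; have [dr|rd] := leP delta0 r => nr xc.
- exact: large.
- by rewrite expr0 mul1r in nr; lra.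
- exact: large.
have [[y0 Vy0]|V0] := pselect (preimage_branches V !=set0); last first.
  apply: (@le_trans _ _ 0); last first.
    by rewrite mulr_ge0 ?fn// mulr_ge0 ?powR_ge0 ?ltW.
  rewrite -[leRHS](transfer_iter0 c s n.+1 x) !iterSr.
  apply: (@transfer_iter_le _ c s _ _ _ _ _ itv_branch) => // y yc.
  rewrite /transfer !indicE !memNset ?addr0// => Vy; apply: V0; exists y.
    by split=> //; eexists; exact: Vy.
  by split=> //; eexists; exact: Vy.
have [y0c _] := Vy0.
have [diam_pre ind_pre] := transfer_indic_le r0 rd Vr Vy0.
have wy0 := width_ge y0c; rewrite -/kappa in wy0.
pose M := width c y0 + 2 * r; pose m := width c y0 - 2 * r.
have m0' : 0 < m by rewrite /m; lra.
have M0 : 0 < M by rewrite /M; lra.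
(* As M >= kappa, one step back enlarges the size enough to keep the hypothesis with one iterate
   fewer. *)
have nr' : delta0 <= kappa ^+ n * (M * r).
  have kn : 0 <= kappa ^+ n by rewrite exprn_ge0//; lra.
  apply: (le_trans nr); rewrite exprSr -mulrA ler_wpM2l// ler_wpM2r ?(ltW r0)//.
  by rewrite /M; lra.
have Mr0 : 0 < M * r by rewrite mulr_gt0.
rewrite !iterSr; apply: (@le_trans _ _ (iter n (transfer c s)
    (fun y => m `^ (- s) * \1_(preimage_branches V) y) x)).
  exact: (@transfer_iter_le _ c s _ _ _ _ _ itv_branch).
rewrite transfer_iterZ.
apply: (le_trans (ler_wpM2l (powR_ge0 _ _) (ih _ _ Mr0 diam_pre nr' xc))).
have Tn := fn n x xc.
apply: (@le_trans _ _ (C * r `^ s * (Theta * iter n (transfer c s) f x))).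
  rewrite powRM ?(ltW M0) ?(ltW r0)//.
  have -> : m `^ (- s) * (C * (M `^ s * r `^ s) * iter n (transfer c s) f x) =
      C * r `^ s * (M `^ s * m `^ (- s) * iter n (transfer c s) f x) by ring.
  rewrite ler_wpM2l ?mulr_ge0 ?powR_ge0 ?(ltW C0)// ler_wpM2r//.
  have Mm : M / m <= Theta.
    rewrite ler_pdivrMr// /M /m.
    have dE : 2 * delta0 * (Theta + 1) = kappa * (Theta - 1).
      by rewrite /delta0; field; rewrite gt_eqF//; lra.
    have h1 : 2 * r * (Theta + 1) <= kappa * (Theta - 1).
      by rewrite -dE ler_pM2r; lra.
    have h2 : kappa * (Theta - 1) <= width c y0 * (Theta - 1).
      by rewrite ler_pM2r; lra.
    lra.
  have mM : 1 <= M / m by rewrite ler_pdivlMr// /M /m; lra.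
  rewrite -mulN1r powRrM powR_inv1 ?(ltW m0')//.
  rewrite -powRM ?invr_ge0 ?(ltW M0) ?(ltW m0')//.
  (* Here s < a <= 1 and M / m >= 1 give (M / m)^s <= M / m. *)
  apply: le_trans Mm; rewrite -[leRHS]powRr1 ?(le_trans _ mM)//.
  by apply: ler_powR => //; move: sa a1 => ? ?; lra.
rewrite ler_wpM2l ?mulr_ge0 ?powR_ge0 ?(ltW C0)// -transfer_iterZ.
apply: (@transfer_iter_le _ c s _ _ _ _ _ itv_branch) => // y.
exact: transfer_gain.
Qed.

Lemma indic_bound : exists C' delta : R, [/\ 0 < C', 0 < delta &
  forall n (V : set R) (r x : R), 0 < r ->
  (forall y z, V y -> V z -> `|y - z| <= r) -> delta <= kappa ^+ n * r ->
  0 <= x <= c ->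
  iter n (transfer c s) \1_V x <= C' * r `^ s * iter n (transfer c s) f x].
Proof.
exists C, delta0; split; first by rewrite invr_gt0 mulr_gt0 ?powR_gt0.
  exact: delta0_gt0.
exact: transfer_iter_indic_le.
Qed.

End Exponent.
(** If the measure vanished, some cover would have a tiny gauge sum; thickened to open sets, it has
    a finite subcover by compactness. Summing [indic_bound] over that subcover would bound L_s^n f x
    by half of itself. *)
Lemma hausdorff_measure_neq0 (s : R) : 0 <= s -> s < a ->
  hausdorff_measure s J <> 0%E.
Proof.
move=> s0 sa Js; have k1 := width_gt1 c5; have c0 : 0 <= c by move: c5; lra.
have fc : {within `[0, c], continuous f} by exact: continuous_subspaceT.
have [x0 x0c fmin] := EVT_min c0 fc; have [x1 x1c fmax] := EVT_max c0 fc.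
have m0 : 0 < f x0 by apply: f_gt0; rewrite in_itv in x0c.
have M0 : 0 < f x1 by apply: f_gt0; rewrite in_itv in x1c.
have m0le (x : R) : 0 <= x <= c -> f x0 <= f x.
  by move=> xc; apply: fmin; rewrite in_itv.
have [C [delta [C0 delta_gt0 bound]]] := indic_bound s0 sa m0 m0le.
(* Thickening raises the gauge sum to less than 2 e, and f x1 * C * 2 e = 1/2. *)
pose e := (4 * f x1 * C)^-1.
have e0 : 0 < e by rewrite invr_gt0 !mulr_gt0.
have : (hausdorff_content s 1 J < e%:E)%E.
  apply: (@le_lt_trans _ _ 0%E); last by rewrite lte_fin.
  by rewrite -Js; apply: ereal_sup_ubound; exists 1 => //=.
move=> /ereal_inf_lt[_ [U [JU Udiam] <-] Ue].
(* These allowances add up to [e] over all k. *)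
have eta0 k : 0 < e / (2 ^ k.+1)%:R :> R by rewrite divr_gt0// ltr0n expn_gt0.
have [V Vprop] := choice (fun k => open_thickening s0 (eta0 k) (Udiam k)).
have : cover_compact J.
  rewrite -compact_cover.
  apply: (subclosed_compact J_closed (@segment_compact _ 0 c)).
  by move=> x /J_itv; rewrite /= in_itv.
move=> /(_ nat setT (fun k => (V k).1.1))[].
- by move=> k _; have [] := Vprop k.
- by move=> x /JU[k _ Uk]; exists k => //; have [_ + _ _ _] := Vprop k; apply.
move=> D _ JD.
pose N := (\max_(k <- finmap.enum_fset D) k).+1.
have {}JD x : J x -> exists2 k, (k < N)%N & (V k).1.1 x.
  move=> /JD[k /= kD Vk]; exists k => //.
  by rewrite ltnS; exact: leq_bigmax_seq.
have ki : 0 <= kappa^-1 < 1.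
  by rewrite invr_ge0 (le_trans ler01 (ltW k1))/= invf_lt1// (lt_trans ltr01).
have kp n : 0 < kappa ^+ n by rewrite exprn_gt0// (lt_trans ltr01).
have deep k : exists n0, forall n, (n0 <= n)%N ->
    delta <= kappa ^+ n * (V k).1.2.
  have [_ _ r0 _ _] := Vprop k.
  have [n0 h] := expr_eventually_le ki (divr_gt0 r0 delta_gt0).
  by exists n0 => n /h; rewrite exprVn ler_pdivlMr// ler_pdivrMl.
have [n0 n0P] := choice deep.
(* Finiteness of the subcover provides a single depth that suits all its sets. *)
pose n := \max_(k < N) n0 k; have [x Jx] := J0; have xc := J_itv Jx.
pose T := transfer c s.
have Tf0 : 0 < iter n T f x by exact: transfer_iter_gt0.
have Vk (k : 'I_N) : iter n T \1_(V k).1.1 x <= C * (V k).2 * iter n T f x.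
  have [_ _ r0 Vr [rs [g0 _]]] := Vprop k.
  have [/rs rg|V0] := pselect ((V k).1.1 !=set0).
    apply: (le_trans (bound n _ _ _ r0 Vr _ xc)).
      by apply: n0P; exact: (leq_bigmax k).
    by rewrite ler_wpM2r ?(ltW Tf0)// ler_wpM2l ?(ltW C0).
  have -> : \1_(V k).1.1 = (fun=> 0) :> (R -> R).
    by apply/funext => y; rewrite indicE memNset// => Vy; apply: V0; exists y.
  by rewrite transfer_iter0 !mulr_ge0 ?(ltW C0) ?(ltW Tf0).
have sum_ge : iter n T f x <=
    f x1 * (C * (\sum_(k < N) (V k).2) * iter n T f x).
  apply: (@le_trans _ _ (iter n T
      (fun y => f x1 * \sum_(k < N) \1_(V k).1.1 y) x)).
    (* The comparison takes place on [J], the only set known to be covered. *)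
    apply: (@transfer_iter_le _ c s J) => // y Jy.
    apply: (@le_trans _ _ (f x1 * 1)).
      by rewrite mulr1 fmax// in_itv /= J_itv.
    rewrite ler_wpM2l ?(ltW M0)//; have [k kN Vy] := JD _ Jy.
    rewrite (bigD1 (Ordinal kN)) //= indicE mem_set// lerDl.
    by apply: sumr_ge0 => i _; rewrite indicE ler0n.
  rewrite transfer_iterZ transfer_iter_sum ler_wpM2l ?(ltW M0)//.
  rewrite mulr_sumr mulr_suml; apply: ler_sum => k _; exact: Vk.
have sum_lt : \sum_(k < N) (V k).2 < 2 * e.
  rewrite -lte_fin -sumEFin.
  apply: (@le_lt_trans _ _
    (\sum_(0 <= k <oo) hausdorff_gauge s (U k) + e%:E)%E); last first.
    by rewrite mulr_natl mulr2n EFinD lte_leD.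
  apply: le_trans (@epsilon_trick _ _ e xpredT _ (ltW e0)); last first.
    by move=> k; exact: hausdorff_gauge_ge0.
  apply: le_trans (nneseries_lim_ge N _); last first.
    move=> k _ _; rewrite adde_ge0 ?hausdorff_gauge_ge0// lee_fin ltW//.
  rewrite big_mkord; apply: lee_sum => k _.
  by have [_ _ _ _ [_ [_]]] := Vprop k.
move: sum_ge; rewrite mulrA -[leLHS]mul1r ler_pM2r// leNgt => /negP; apply.
apply: (@lt_trans _ _ (f x1 * (C * (2 * e)))); first by rewrite !ltr_pM2l.
have -> : f x1 * (C * (2 * e)) = 2^-1 by rewrite /e; field; rewrite !gt_eqF.
lra.
Qed.

Lemma hausdorff_dim_ge : (a%:E <= hausdorff_dim J)%E.
Proof.
apply: le_ereal_inf_tmp => _ [s /= [s0 Js] <-]; rewrite lee_fin leNgt.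
by apply/negP => sa; exact: hausdorff_measure_neq0 Js.
Qed.

End LowerBound.

(** * Numerical data and certificates for d = 2, ..., 10 *)

Local Open Scope Z_scope.

(* The coefficients were computed by collocation at Chebyshev nodes for the
   eigenfunction of eigenvalue 1 of the transfer operator at the dimension. *)
Definition julia_poly (d : nat) : seq (Z * Z) :=
  match d with
  | 2%nat => [:: (14151455685259941636, 2004029649677262958);
      (1084767873231740067, 513001577852348490);
      (289014338484583928, 163435740052420389);
      (96286322045163711, 57524374794297301);
      (34918494003827790, 21412982638989344);
      (13247758221157720, 8252913319859981);
      (5171359030200329, 3256255385761914);
      (2058946124429659, 1306580865080455); (831779454026627, 530966629767989);
      (339565148444622, 217767025582517); (141136586364878, 90871390789652);
      (53125825802274, 34236022493635); (42094187120612, 27465895706072);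
      (-41264695585605, -27318430137602); (124748598607404, 82220142504875);
      (-227523544041307, -150044506594669); (355428666559582, 234361953442957);
      (-443199951082053, -292241583779861); (444876424482525, 293339348386527);
      (-352551948458276, -232459569797453); (216302021233604, 142617836762233);
      (-99121905962155, -65353822503162); (32048335085807, 21129545305439);
      (-6541212690086, -4312430494937); (641446870843, 422852104797)]
  | 3%nat => [:: (15914022593929897827, 1579795263446817305);
      (539316991953424271, 197358329341511170);
      (80039160655504059, 33837051017335421);
      (14748662101551194, 6561938496101489);
      (2964605448475026, 1355188628599248); (625281021562070, 290691485505708);
      (135989948081741, 63954127569431); (30212277870452, 14327878696585);
      (6817443538714, 3253727799169); (1558436909877, 747528013168);
      (355775206879, 171308328145); (89242054829, 43165256940);
      (11558996147, 5551058525); (12623360480, 6171793187);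
      (-4826205835, -2372822593); (3271006466, 1604274268);
      (-915625634, -449388512); (176120004, 86367673)]
  | 4%nat => [:: (16723376484788173565, 1229042332656016406);
      (314147494522749038, 91765251839522802);
      (29420501752923625, 9888971069672720);
      (3429135148471062, 1215076092046680); (437466500949518, 159440402916656);
      (58675666698050, 21763587027478); (8125080563042, 3050009893512);
      (1150267069770, 435560921251); (165534698239, 63096884436);
      (24066850740, 9220863765); (3613083442, 1390513878);
      (460712474, 177589862); (123172722, 47832098); (-7568164, -2979190);
      (6278187, 2447479)]
  | 5%nat => [:: (68660242328704373000, 3931144330776046024);
      (808156673498152722, 195699802131458403);
      (51947293990172099, 14487919573037224);
      (4171793116017524, 1228251241115517); (367583439290621, 111397093955569);
      (34096058045988, 10520400607235); (3267792648926, 1020730590927);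
      (320365203992, 100964736327); (31931693225, 10131664549);
      (3227850588, 1029640425); (324371158, 103893416); (37179154, 11961842);
      (1847665, 592628); (807563, 261472)]
  | 6%nat => [:: (17440261549483571783, 808224027978167034);
      (139260729197148559, 28765178445813128);
      (6516119947403186, 1552833067952909); (382296087791360, 96273398779428);
      (24651725823362, 6393450057168); (1674987582422, 442431904141);
      (117658746435, 31468690148); (8458106123, 2282764173);
      (617498402, 167801965); (46588792, 12731628); (2939435, 805600);
      (421774, 116322)]
  | 7%nat => [:: (17625886595305822774, 680434769973898983);
      (100999157470637338, 18179423670580480);
      (3591660997307825, 747139228084226); (160639710295910, 35340642106399);
      (7907322801321, 1792279007620); (410419280725, 94766461617);
      (22032639955, 5152078156); (1210394300, 285642363); (68010409, 16163129);
      (3600743, 859872); (307651, 73924)]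
  | 8%nat => [:: (17758262024619256466, 583896556674000756);
      (76153550340834107, 12142496456609638);
      (2126966226237961, 392546373825956); (74908371439570, 14630178335127);
      (2906569698159, 585048353030); (118985640028, 24402744150);
      (5039591189, 1046847137); (218519766, 45814116); (9664096, 2040495);
      (415694, 88224); (25403, 5422)]
  | 9%nat => [:: (17857356894848182995, 508962874502710065);
      (59208489709392249, 8472025969186673);
      (1332844578988889, 221044116792711); (37915906092871, 6657840294494);
      (1189381498794, 215296480349); (39380570604, 7264373887);
      (1349401972, 252142484); (47389033, 8938044); (1660898, 315423);
      (74222, 14189)]
  | 10%nat => [:: (17933833488411423627, 449419993850149658);
      (47187699023116438, 6123048854717322);
      (874205468987091, 131630423046429); (20504737010615, 3270367114089);
      (530723451965, 87278686465); (14504624439, 2431101838);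
      (410468067, 69695588); (11783384, 2019395); (404012, 69797)]
  | _ => [::]
  end.

Local Close Scope Z_scope.

(** The exponents are A / 10^14 and (A + 1) / 10^14; A + 1 < B keeps both below 1, as the two
    dimension bounds require. Logarithms are computed in units of 2^(-80). *)
Definition julia_certificate (d : nat) : bool :=
  let A := digits_val (julia_dim_digits d) in
  let B := Z.pow (Z.of_nat 10) (Z.of_nat (size (julia_dim_digits d))) in
  [&& size (julia_dim_digits d) == 14%N, Z.leb Z0 A,
     Z.ltb (Z.add A (Zpos xH)) B &
     certificate (Z.pow (Z.of_nat 2) (Z.of_nat 80)) (Z.of_nat (3 + d)) A B
       (julia_poly d)].

Lemma julia_certificate_ok : all julia_certificate (iota 2 9).
Proof. by vm_compute. Qed.

Lemma decimalE (R : realType) (s : seq nat) :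
  decimal s = ZR (digits_val s) / 10 ^+ size s :> R.
Proof.
elim: s => [|k s ih]; first by rewrite /decimal /= ZR0 mul0r.
have -> : decimal (k :: s) = (k%:R + decimal s) / 10 :> R by [].
have -> : digits_val (k :: s) = Z.add (Z.mul (Z.of_nat k)
  (Z.pow (Z.of_nat 10) (Z.of_nat (size s)))) (digits_val s) by [].
rewrite ih ZRD ZRM ZRX !ZR_nat [size (k :: s)]/= exprS.
by field; rewrite expf_neq0.
Qed.

(** * The dimension of the Julia set *)

Section JuliaDimension.
Context {R : realType}.
Variable d : nat.
Hypothesis d2 : (2 <= d)%N.

Let c : R := 3 + d%:R.

Lemma local_inverse_branch (e : bool) :
  local_inverse d ((-1) ^+ e) = branch c e.
Proof.
apply/funext => x; rewrite /local_inverse /branch /width mulrC.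
by congr ((_ + _ * Num.sqrt _) / _); rewrite /c; ring.
Qed.

Lemma julia_set_branch :
  let J : set R := julia_set d in
  [/\ forall x, J x -> 0 <= x <= c, closed J, J !=set0 &
      J = branch c true @` J `|` branch c false @` J].
Proof.
move=> J; have [Jb Jc J0 JE] := julia_set_invariant (R := R) d2; split=> //.
by rewrite -!local_inverse_branch; exact: JE.
Qed.

Lemma hausdorff_dim_julia_bounds T A B s : 0 <= ZR A :> R ->
  ZR A + 1 < ZR B :> R -> certificate T (Z.of_nat (3 + d)) A B s ->
  ((ZR A / ZR B)%:E <= hausdorff_dim (julia_set d : set R) <=
   ((ZR A + 1) / ZR B)%:E)%E.
Proof.
move=> A0 AB; have cE : ZR (Z.of_nat (3 + d)) = c by rewrite ZR_nat natrD.
have c5 : 5 <= c by rewrite /c -(natrD _ 3) (ler_nat _ 5) (leq_add2l 3 2).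
have c0 : 0 < c by lra.
have B0 : 0 < ZR B :> R by lra.
have c4 : 4 < ZR (Z.of_nat (3 + d)) :> R by rewrite cE; lra.
move=> /(certificateP c4 A0 B0)[]; rewrite cE => g_gt0 g_ineq.
pose f x : R := peval (interleave s) (2 / c * x - 1).
have fc : continuous f.
  move=> x; apply: (@continuous_comp _ _ _ (fun x => 2 / c * x - 1)).
    apply: continuousB; last exact: cvg_cst.
    by apply: continuousM; [exact: cvg_cst|exact: cvg_id].
  exact: continuous_peval.
have zc x : 0 <= x <= c -> -1 <= 2 / c * x - 1 <= 1.
  move=> /andP[x0 xc]; have : 0 <= 2 / c * x <= 2.
    rewrite mulr_ge0 ?divr_ge0 ?(ltW c0)//=.
    by rewrite mulrAC ler_pdivrMr// ler_pM2l.
  by move=> /andP[? ?]; apply/andP; split; lra.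
have f0 x : 0 <= x <= c -> 0 < f x by move=> /zc /g_gt0.
(* In the coordinate 2 x / c - 1 the branch values (c -+ w) / 2 become -+ w / c. *)
have fS e x : f (branch c e x) =
    peval (interleave s) ((-1) ^+ e * (width c x / c)).
  by rewrite /f /branch; congr peval; field; rewrite gt_eqF.
have ineq x : 0 <= x <= c -> f x <= transfer c (ZR A / ZR B) f x /\
    transfer c ((ZR A + 1) / ZR B) f x <= f x.
  move=> xc; have w0 := width_gt0 c5 xc; have w2 := width_sqr c5 xc.
  have w2' : width c x ^+ 2 = c * (c - 2 - 2 * (2 / c * x - 1)).
    by rewrite w2; field; rewrite gt_eqF.
  have := g_ineq _ _ (zc x xc) w0 w2'.
  by rewrite /transfer !fS expr1 expr0 mul1r mulN1r.
have [J_itv J_closed J0 JE] := julia_set_branch.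
apply/andP; split.
- apply: (@hausdorff_dim_ge _ c (ZR A / ZR B) f) => //.
  + by rewrite ler_pdivrMr//; lra.
  + by move=> x /ineq[].
  + by move=> e x Jx; rewrite JE; case: e; [left|right]; exists x.
- apply: (@hausdorff_dim_le _ c ((ZR A + 1) / ZR B) f) => //.
  + by rewrite divr_ge0 ?ltW//; lra.
  + by rewrite ltr_pdivrMr//; lra.
  + by move=> x /ineq[].
Qed.

End JuliaDimension.

Theorem theorem3p2 (R : realType) (d : nat) (hd : (2 <= d <= 10)%N) :
  let a : R := decimal (julia_dim_digits d) in
  (a%:E <= hausdorff_dim (@julia_set R d) <= (a + 10 ^- 14)%:E)%E.
Proof.
have d2 : (2 <= d)%N by case/andP: hd.
have /(allP julia_certificate_ok) : d \in iota 2 9 by rewrite mem_iota.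
move=> /and4P[/eqP size14 A0 AB cert].
have := @ltr_ZR R _ _ AB; rewrite ZRD => {}AB.
have := hausdorff_dim_julia_bounds d2 (@ler_ZR R _ _ A0) AB cert.
by rewrite decimalE ZRX ZR_nat size14 mulrDl mul1r.
Qed.
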